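(* Let $$\gamma(r)=\sup_{|x|=r}\frac{r\big(\operatorname{tr}(a(x))+\langle b(x),x\rangle\big)}{\langle a(x)x,x\rangle}-\frac1r,\qquad C(r)=\int_1^r\gamma(s)\,ds,\qquad \alpha(r)=\inf_{|x|=r}\frac1{r^2}\langle a(x)x,x\rangle,\qquad r>0.$$ If there exists a positive $f\in C[1,\infty)$ such that $$\sup_{t\ge1}\frac1{f(t)}\int_1^t e^{-C(r)}\,dr\int_r^\infty e^{C(s)}\frac{f(s)}{\alpha(s)}\,ds<\infty,$$ then $\lambda_1(a,V)>0$.
   Context: Setting. On $\mathbb R^d$ consider the operator $$L=\sum_{i,j=1}^d a_{ij}(x)\partial_i\partial_j+\sum_{i=1}^d b_i(x)\partial_i,$$ where $\partial_i=\partial/\partial x_i$, $a(x)=(a_{ij}(x))$ is a (symmetric) positive definite matrix for each $x$, $a_{ij}\in C^2(\mathbb R^d)$, and $b_i=\sum_{j=1}^d(a_{ij}\partial_jV+\partial_ja_{ij})$ for some $V\in C^2(\mathbb R^d)$ with $Z:=\int_{\mathbb R^d} e^{V}dx<\infty$. Then $L$ is symmetric with respect to the probability measure $d\mu=Z^{-1}e^{V}dx$; write $\mu(f)=\int f\,d\mu$. The spectral gap of $L$ is $$\lambda_1=\lambda_1(a,V)=\inf\{\mu(\langle a\nabla f,\nabla f\rangle): f\in C^1(\mathbb R^d),\ \mu(f)=0,\ \mu(f^2)=1\}.$$ Standing assumption: $L$ is regular, in the sense that $C_0^\infty(\mathbb R^d)$ is dense in $W^{1,2}(\mathbb R^d,d\mu)$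 with the Sobolev norm $\|f\|_{L^2(\mu)}+\|\sqrt{\langle a\nabla f,\nabla f\rangle}\|_{L^2(\mu)}$. *)

(* Defs.v *)
From HB Require Import structures.
From mathcomp Require Import all_boot all_order all_algebra.
From mathcomp Require Import all_classical all_reals all_analysis.

Set Implicit Arguments.
Unset Strict Implicit.
Unset Printing Implicit Defensive.
Import Order.TTheory GRing.Theory Num.Theory.
Import numFieldNormedType.Exports.

Local Open Scope classical_set_scope.
Local Open Scope ring_scope.

(* R^n is 'rV[R]_n, with the sigma-algebra generated by the coordinates (as the
   library does for tuples); since R is second countable, this is the Borel
   sigma-algebra. *)
Section measurable_rV.
Context {R : realType} (n : nat).

Let coors : 'I_n -> 'rV[R]_n -> R := fun i x => x ord0 i.

Let rV_set0 : g_sigma_preimage coors set0.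
Proof. exact: sigma_algebra0. Qed.

Let rV_setC A : g_sigma_preimage coors A -> g_sigma_preimage coors (~` A).
Proof. exact: sigma_algebraC. Qed.

Let rV_bigcup (F : _^nat) : (forall i, g_sigma_preimage coors (F i)) ->
  g_sigma_preimage coors (\bigcup_i (F i)).
Proof. exact: sigma_algebra_bigcup. Qed.

HB.instance Definition _ := @isMeasurable.Build default_measure_display
  'rV[R]_n (g_sigma_preimage coors) rV_set0 rV_setC rV_bigcup.

Lemma measurable_coord (i : 'I_n) :
  measurable_fun [set: 'rV[R]_n] (fun x : 'rV[R]_n => x ord0 i).
Proof.
move=> _ Y mY; rewrite setTI; apply: sub_sigma_algebra => /=.
rewrite -bigcup_seq/=; exists i => /=; first by rewrite mem_index_enum.
by exists Y => //; rewrite setTI.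
Qed.

Lemma measurable_fun_rV d (T : measurableType d) (h : T -> 'rV[R]_n) :
  (forall i, measurable_fun setT (fun t => h t ord0 i)) ->
  measurable_fun setT h.
Proof.
move=> mh; apply: (@measurability _ _ _ _ _ _
  (\big[setU/set0]_(i < n) preimage_set_system setT (coors i) measurable)) => //.
move=> _ [B + <-]; rewrite -bigcup_seq /= => -[i _ [C mC <-]].
by rewrite !setTI; have := mh i measurableT C mC; rewrite setTI.
Qed.

End measurable_rV.

Section lebesgue_rV.
Context {R : realType}.

Definition cons_rV n (p : R * 'rV[R]_n) : 'rV[R]_n.+1 :=
  row_mx (p.1%:M : 'rV[R]_1) p.2.

Definition uncons_rV n (x : 'rV[R]_n.+1) : R * 'rV[R]_n :=
  (x ord0 ord0, \row_i x ord0 (lift ord0 i)).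

Lemma cons_rV0 n (p : R * 'rV[R]_n) : cons_rV p ord0 ord0 = p.1.
Proof.
rewrite /cons_rV (_ : ord0 = lshift n (ord0 : 'I_1)); last exact: val_inj.
by rewrite (row_mxEl (p.1%:M : 'rV[R]_1)) mxE eqxx.
Qed.

Lemma cons_rVS n (p : R * 'rV[R]_n) i : cons_rV p ord0 (lift ord0 i) = p.2 ord0 i.
Proof.
rewrite /cons_rV (_ : lift ord0 i = rshift 1 i); last exact: val_inj.
by rewrite (row_mxEr (p.1%:M : 'rV[R]_1)).
Qed.

Lemma cons_rVK n : cancel (@cons_rV n) (@uncons_rV n).
Proof.
move=> [y z]; rewrite /uncons_rV cons_rV0; congr pair.
by apply/rowP => i; rewrite mxE cons_rVS.
Qed.

Lemma measurable_cons_rV n : measurable_fun setT (@cons_rV n).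
Proof.
apply: measurable_fun_rV => i; case: (unliftP ord0 i) => [j|] ->.
  under eq_fun do rewrite cons_rVS.
  exact: (measurableT_comp (measurable_coord j)).
under eq_fun do rewrite cons_rV0.
exact: measurable_fst.
Qed.

Lemma measurable_uncons_rV n : measurable_fun setT (@uncons_rV n).
Proof.
apply: measurable_fun_pair; first exact: measurable_coord.
apply: measurable_fun_rV => i; under eq_fun do rewrite mxE.
exact: measurable_coord.
Qed.

Section step.
Context n (m : {sigma_finite_measure set 'rV[R]_n -> \bar R}).

Definition lebesgue_step : set 'rV[R]_n.+1 -> \bar R :=
  pushforward ((@lebesgue_measure R) \x m)%E (@cons_rV n).

Let step0 : lebesgue_step set0 = 0%E.
Proof. by rewrite /lebesgue_step /pushforward preimage_set0 measure0. Qed.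

Let step_ge0 A : (0 <= lebesgue_step A)%E.
Proof. by rewrite /lebesgue_step /pushforward; exact: measure_ge0. Qed.

Let step_sigma_additive : semi_sigma_additive lebesgue_step.
Proof.
move=> F mF tF mUF; rewrite /lebesgue_step /pushforward preimage_bigcup.
apply: measure_semi_sigma_additive.
- by move=> k; rewrite -[X in measurable X]setTI; exact: measurable_cons_rV.
- apply/trivIsetP => /= i j _ _ ij; rewrite -preimage_setI.
  by move/trivIsetP : tF => /(_ i j Logic.I Logic.I ij) ->; rewrite preimage_set0.
- by rewrite -preimage_bigcup -[X in measurable X]setTI; exact: measurable_cons_rV.
Qed.

HB.instance Definition _ := isMeasure.Build _ _ _ lebesgue_step
  step0 step_ge0 step_sigma_additive.

Let step_sigma_finite : sigma_finite setT lebesgue_step.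
Proof.
have /sigma_finiteP[F [TF ndF Foo]] := sigma_finiteT (@lebesgue_measure R).
have /sigma_finiteP[G [TG ndG Goo]] := sigma_finiteT m.
exists (fun k => @uncons_rV n @^-1` (F k `*` G k)).
  rewrite -preimage_bigcup [X in _ @^-1` X](_ : _ = setT) ?preimage_setT//.
  rewrite -setXTT TF TG predeqE => -[x y]; split.
    by move=> [k _ []/= ? ?]; split; exists k.
  move=> [/= [i _ Fix] [k _ Gky]]; exists (maxn i k) => //; split.
  - by move: x Fix; exact/subsetPset/ndF/leq_maxl.
  - by move: y Gky; exact/subsetPset/ndG/leq_maxr.
move=> k; have [mF Fk] := Foo k; have [mG Gk] := Goo k; split.
  by rewrite -[X in measurable X]setTI; apply: measurable_uncons_rV => //;
    exact: measurableX.
rewrite /lebesgue_step /pushforward -comp_preimage (_ : _ \o _ = id); last first.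
  by apply/funext => p /=; rewrite cons_rVK.
by rewrite preimage_id product_measure1E// lte_mul_pinfty// ge0_fin_numE.
Qed.

HB.instance Definition _ :=
  Measure_isSigmaFinite.Build _ _ _ lebesgue_step step_sigma_finite.

End step.

(* Lebesgue measure on R^n: Dirac at the only point if n = 0, and the image of
   lebesgue_measure \x lebesgue_rV n' by (t, x) |-> (t, x_1, ..., x_n') if
   n = n'.+1. *)
Fixpoint lebesgue_rV (n : nat) : {sigma_finite_measure set 'rV[R]_n -> \bar R} :=
  if n is n'.+1 then lebesgue_step (lebesgue_rV n') else \d_(0 : 'rV[R]_0).

End lebesgue_rV.

Section calculus.
Context {R : realType} {d : nat}.
Implicit Types (f V : 'rV[R]_d -> R) (x u v : 'rV[R]_d).

Definition inner u v : R := \sum_i u ord0 i * v ord0 i.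

(* The matrix-vector product, on row vectors. *)
Definition mulrV (A : 'M[R]_d) u : 'rV[R]_d := u *m A^T.

(* The norm `|x| of 'rV[R]_d is the sup norm. *)
Definition enorm x : R := Num.sqrt (inner x x).

Definition sphere (r : R) : set 'rV[R]_d := [set x | enorm x = r].

Definition sym_posdef (A : 'M[R]_d) : Prop :=
  A^T = A /\ forall v, v != 0 -> 0 < inner (mulrV A v) v.

Definition partial f (i : 'I_d) : 'rV[R]_d -> R :=
  fun x => 'D_(delta_mx ord0 i) f x.

Definition grad f x : 'rV[R]_d := \row_i partial f i x.

Fixpoint Ck (k : nat) f : Prop :=
  if k is k'.+1 then
    continuous f /\
    forall i, (forall x, derivable f x (delta_mx ord0 i)) /\ Ck k' (partial f i)
  else continuous f.

(* The functions of C_0^oo(R^d) *)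
Definition test_function f : Prop :=
  (forall k, Ck k f) /\ compact (closure [set x | f x != 0]).

Definition loc_integrable f : Prop :=
  measurable_fun setT f /\
  forall K : set 'rV[R]_d, compact K ->
    (lebesgue_rV d).-integrable K (EFin \o f).

Definition weak_gradient f (g : 'rV[R]_d -> 'rV[R]_d) : Prop :=
  [/\ loc_integrable f,
      (forall i, loc_integrable (fun x => g x ord0 i)) &
      forall phi i, test_function phi ->
        (\int[lebesgue_rV d]_x (f x * partial phi i x)%:E =
         - \int[lebesgue_rV d]_x (g x ord0 i * phi x)%:E)%E].

End calculus.

Section elliptic_operator.
Context {R : realType} {d : nat}.
Variables (a : 'rV[R]_d -> 'M[R]_d) (V : 'rV[R]_d -> R).
Implicit Types (f : 'rV[R]_d -> R) (g : 'rV[R]_d -> 'rV[R]_d).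

Definition drift (x : 'rV[R]_d) : 'rV[R]_d :=
  \row_i \sum_j (a x i j * partial V j x + partial (fun y => a y i j) j x).

Definition partition_function : \bar R :=
  \int[lebesgue_rV d]_x (expR (V x))%:E.

(* mu = Z^-1 e^V dx, as a bare set function: it is a probability measure as soon
   as V is measurable and partition_function is finite. *)
Definition gibbs : set 'rV[R]_d -> \bar R := fun A =>
  ((fine partition_function)^-1%:E *
   \int[lebesgue_rV d]_(x in A) (expR (V x))%:E)%E.

Definition L2norm (h : 'rV[R]_d -> R) : \bar R :=
  ((\int[gibbs]_x ((h x) ^+ 2)%:E) `^ 2^-1)%E.

(* The norm of W^{1,2}(R^d, mu), at a function f with gradient g. *)
Definition sobolev_norm f g : \bar R :=
  (L2norm f + L2norm (fun x => Num.sqrt (inner (mulrV (a x) (g x)) (g x))))%E.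

(* C_0^oo is dense in W^{1,2}(R^d, mu), whose elements are the f with a weak
   gradient g such that sobolev_norm f g is finite. *)
Definition regular : Prop :=
  forall f g, weak_gradient f g -> (sobolev_norm f g < +oo)%E ->
  forall e : R, 0 < e ->
  exists2 phi, test_function phi &
    (sobolev_norm (fun x => f x - phi x)%R (fun x => g x - grad phi x)%R < e%:E)%E.

Definition spectral_gap : \bar R :=
  ereal_inf [set (\int[gibbs]_x (inner (mulrV (a x) (grad f x)) (grad f x))%:E)%E
    | f in [set f | [/\ Ck 1 f,
                        (\int[gibbs]_x (f x)%:E = 0)%E &
                        (\int[gibbs]_x ((f x) ^+ 2)%:E = 1)%E]]].

Definition gamma (r : R) : R :=
  sup [set r * (\tr (a x) + inner (drift x) x) / inner (mulrV (a x) x) x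
      | x in sphere r] - r^-1.

(* The oriented integral of gamma from 1 to r. *)
Definition Cint (r : R) : R :=
  if 1 <= r then \int[lebesgue_measure]_(s in `[1, r]) gamma s
  else - \int[lebesgue_measure]_(s in `[r, 1]) gamma s.

Definition alpha (r : R) : R :=
  inf [set (r ^+ 2)^-1 * inner (mulrV (a x) x) x | x in sphere r].

End elliptic_operator.

(* Main.v *)
Require Import Defs.
From HB Require Import structures.
From mathcomp Require Import all_boot all_order all_algebra.
From mathcomp Require Import all_classical all_reals all_analysis.
From mathcomp Require Import measurable_realfun.
From mathcomp Require Import ring lra.
Import Order.TTheory GRing.Theory Num.Theory.
Import numFieldNormedType.Exports.
Local Open Scope classical_set_scope.
Local Open Scope ring_scope.

Set Implicit Arguments.
Unset Strict Implicit.
Unset Printing Implicit Defensive.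

Local Notation mulrV := Defs.mulrV.

(** The hypothesis on f makes F(t) = int_1^t e^(-C(r)) int_r^oo e^C f / alpha finite,
    with F <= c f, and q = F'/F satisfies q' + gamma q + q^2 <= - 1 / (c alpha).
    For h of class C^1 consider the field h^2 e^V k(|x|^2) a(x) x, where
    k(|x|^2) = eta(|x|^2) q(|x|) / |x| and eta cuts off near the origin and near
    infinity. Its divergence integrates to 0 and, by the inequality for q and
    Cauchy-Schwarz for a(x), is at most
    e^V (eta <a grad h, grad h> - eta h^2 / c + K 1_Q h^2) with Q = [-2, 2]^d.
    Letting eta increase bounds int e^V h^2 by the energy of h and int_Q h^2.
    Apply this to h = g - m with mu(g) = 0 and mu(g^2) = 1, so that mu(h^2) >= 1,
    where m is chosen by the Poincare inequality on Q, which bounds int_Q h^2 by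
    the energy of g. *)

(** * Borel functions and cubes in R^n *)

(** [F(|x|)] is a Lyapunov function: [F'' + gamma F' = - f / alpha] and [F' >= 0] give, by the
    extremal definitions of [gamma] and [alpha], [L (F(|x|)) <= - f(|x|) <= - F(|x|) / c] for
    [|x| > 1]. Up to the cut-off, the field is [h^2 e^V a grad (log F(|x|))]. Passing to the
    logarithm turns [F''] into [q' + q^2], and this [q^2] is exactly what absorbs the term [h^2 q^2]
    that Cauchy-Schwarz leaves from the product with [grad h]. The two cut-offs have different
    costs. [F] vanishes at 1, so [q] is singular there, and the inner cut-off must increase with
    [|x|]: its slope produces the term in [1_Q h^2]. The outer one decreases, and since [q >= 0] its
    slope has the favourable sign, so letting it tend to 1 leaves no boundary term to control.
    [gamma] is a spherical supremum, hence merely continuous; [F] is then of class C^2 and the field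
    of class C^1, which is all that integration by parts on slices asks for. The number [m] need not
    be the mean on [Q]: a small additive error in the Poincare inequality is allowed, since half of
    the normalisation [Z] can pay for it. *)

Section rV_topology.
Context {R : realType}.

Lemma cvg_rV n (T : Type) (F : set_system T) {FF : Filter F}
    (g : T -> 'rV[R]_n) (l : 'rV[R]_n) :
  (forall i, (fun t => g t ord0 i) @ F --> l ord0 i) -> g @ F --> l.
Proof.
move=> gl; apply/cvg_ballP => e e0.
have : \forall t \near F, forall i, ball (l ord0 i) e (g t ord0 i).
  by apply: filter_forall => i; exact: (cvg_ball (gl i)).
by apply: filterS => t gt; split => // i j; rewrite (ord1 i).
Qed.

Lemma continuous_rV n (T : topologicalType) (g : T -> 'rV[R]_n) :
  (forall i, continuous (fun t => g t ord0 i)) -> continuous g.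
Proof. by move=> gc x; apply: cvg_rV => i; exact: gc. Qed.

Lemma continuous_coord n (i : 'I_n) : continuous (fun x : 'rV[R]_n => x ord0 i).
Proof. exact: coord_continuous. Qed.

(* A continuous function is the pointwise limit of its values at the points of
   the grids of mesh 1/(k+1), which are countable. *)
Lemma continuous_measurable_rV n (f : 'rV[R]_n -> R) :
  continuous f -> measurable_fun setT f.
Proof.
move=> cf.
pose g (k : nat) (x : 'rV[R]_n) : 'rV[int]_n := \row_i Num.floor (k.+1%:R * x ord0 i).
pose h (k : nat) (v : 'rV[int]_n) : 'rV[R]_n := \row_i ((v ord0 i)%:~R / k.+1%:R).
apply: (@measurable_fun_cvg _ _ _ _ (fun k x => f (h k (g k x)))) => [k|x _].
  move=> _ Y mY; rewrite setTI.
  (* Only boxes are readily measurable for the sigma-algebra of the coordinates. The approximation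
     is constant on each grid cell, so a preimage is a countable union of cells, indexed by the
     integer vectors [v]. *)
  rewrite (_ : _ @^-1` _ = \bigcup_(v : 'rV[int]_n)
      ((if f (h k v) \in Y then [set: 'rV[R]_n] else set0) `&`
       \big[setI/setT]_(i < n) [set x : 'rV[R]_n | Num.floor (k.+1%:R * x ord0 i) = v ord0 i])).
    apply: countable_bigcupT_measurable => // v.
    apply: measurableI; first by case: ifP.
    elim/big_ind : _ => // [|i _]; first exact: measurableI.
    have -> : [set x : 'rV[R]_n | Num.floor (k.+1%:R * x ord0 i) = v ord0 i] =
        (fun x : 'rV[R]_n => k.+1%:R * x ord0 i) @^-1`
          `[(v ord0 i)%:~R, (v ord0 i + 1)%:~R[.
      apply/seteqP; split => x /=; rewrite in_itv/=.
        by move=> <-; rewrite ge_floor floorD1_gt.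
      by move=> ?; exact: floor_def.
    rewrite -[X in measurable X]setTI; apply: measurable_funM => //.
    exact: measurable_coord.
  apply/seteqP; split => [x /= Yx|x [v _ [/=]]].
    exists (g k x) => //; split; first by rewrite mem_set.
    by rewrite -bigcap_seq => i _ /=; rewrite mxE.
  case: ifPn => // /set_mem Yv _; rewrite -bigcap_seq => gv.
  suff -> : g k x = v by [].
  by apply/rowP => i; rewrite mxE; apply: gv => /=; rewrite mem_index_enum.
apply: (@cvg_comp _ _ _ (fun k => h k (g k x)) f _ (nbhs x)); last exact: cf.
apply: cvg_rV => i; under eq_fun do rewrite !mxE.
apply: (@squeeze_cvgr _ _ _ _ (fun k => x ord0 i - k.+1%:R^-1) (fun=> x ord0 i)).
- near=> k; apply/andP; split.
    rewrite ler_pdivlMr// mulrBl mulVf// lerBlDr -[1]/(1%:~R) -intrD mulrC.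
    by rewrite ltW// floorD1_gt.
  by rewrite ler_pdivrMr// mulrC ge_floor.
- rewrite -[X in _ --> X]subr0; apply: cvgB; first exact: cvg_cst.
  exact: cvg_harmonic.
- exact: cvg_cst.
Unshelve. all: by end_near. Qed.

Lemma continuous_cons_rV n (T : topologicalType) (f : T -> R) (g : T -> 'rV[R]_n) :
  continuous f -> continuous g -> continuous (fun t => cons_rV (f t, g t)).
Proof.
move=> cf cg; apply: continuous_rV => i; case: (unliftP ord0 i) => [j|] ->.
  under eq_fun do rewrite cons_rVS /=.
  move=> x; apply: (@continuous_comp _ _ _ g (fun v => v ord0 j)); first exact: cg.
  exact: continuous_coord.
by under eq_fun do rewrite cons_rV0.
Qed.

(** A ball of the sup norm rather than a Euclidean one: its slices along the first coordinate are
    cubes again, as the inductions on the dimension require. *)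
Definition cube (N : R) n : set 'rV[R]_n := [set x | forall i, `|x ord0 i| <= N].
Arguments cube : clear implicits.

Lemma cube_compact N n : compact (cube N n).
Proof.
rewrite (_ : cube N n = [set v : 'rV[R]_n | forall i, v ord0 i \in `[(- N), N]]).
  apply: (@rV_compact _  _ (fun=> `[(- N), N]%classic)) => _.
  exact: segment_compact.
by apply/seteqP; split => x /= xN i; have := xN i; rewrite in_itv/= ler_norml.
Qed.

Lemma cube_measurable N n : measurable (cube N n).
Proof.
rewrite (_ : cube N n = \big[setI/setT]_(i < n)
    (fun x : 'rV[R]_n => x ord0 i) @^-1` `[- N, N]).
  elim/big_ind : _ => // [|i _]; first exact: measurableI.
  rewrite -[X in measurable X]setTI; exact: measurable_coord.
rewrite -bigcap_seq; apply/seteqP; split => x /= xN i.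
  by move=> _ /=; rewrite in_itv/= -ler_norml.
by have := xN i; rewrite /= mem_index_enum in_itv/= -ler_norml; apply.
Qed.

Lemma cube0 N n : 0 <= N -> cube N n 0.
Proof. by move=> N0 i; rewrite mxE normr0. Qed.

Lemma cube_bounded N n (f : 'rV[R]_n -> R) : continuous f ->
  exists2 M : R, 0 < M & forall x, cube N n x -> `|f x| <= M.
Proof.
(* For [N < 0] the cube is empty, except in dimension 0, where the condition is vacuous and the cube
   is the single point 0. *)
move=> cf; have [N0|N0] := leP 0 N; last first.
  case: n f cf => [|n] f cf; last first.
    by exists 1 => // x /(_ ord0); have := normr_ge0 (x ord0 ord0); lra.
  exists (`|f 0| + 1) => [|x _]; first by rewrite ltr_wpDl.
  by rewrite (_ : x = 0) ?lerDl//; apply/rowP; case.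
have cub0 : cube N n !=set0 by exists 0; exact: cube0.
have [|c _ cmax] := compact_EVT_max (f := fun x => `|f x|) cub0 (@cube_compact N n).
  apply: continuous_subspaceT => x; apply: (@continuous_comp _ _ _ f Num.norm).
    exact: cf.
  exact: norm_continuous.
exists (`|f c| + 1); first by rewrite ltr_wpDl.
by move=> x /mem_set/cmax /le_trans; apply; rewrite lerDl.
Qed.

End rV_topology.
Arguments cube {R} N n.

(** * Fubini for the Lebesgue measure of R^n *)

Section fubini_rV.
Context {R : realType}.
Local Notation leb := (@lebesgue_measure R).
Local Notation lebn := (@lebesgue_rV R _).

Section ge0.
Local Open Scope ereal_scope.
Context n (f : 'rV[R]_n.+1 -> \bar R).
Hypotheses (mf : measurable_fun setT f) (f0 : forall x, 0 <= f x).

Lemma measurable_cons_comp : measurable_fun setT (f \o @cons_rV R n).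
Proof. by apply: measurableT_comp => //; exact: measurable_cons_rV. Qed.

Lemma ge0_integral_rVS_prod : \int[lebn]_x f x =
  \int[leb \x lebn]_p (f \o @cons_rV R n) p.
Proof. by rewrite ge0_integral_pushforward//; exact: measurable_cons_rV. Qed.

Lemma ge0_integral_rVS1 : \int[lebn]_x f x =
  \int[leb]_t \int[lebn]_x f (cons_rV (t, x)).
Proof.
rewrite ge0_integral_rVS_prod fubini_tonelli1//; first exact: measurable_cons_comp.
by move=> x; exact: f0.
Qed.

Lemma ge0_integral_rVS2 : \int[lebn]_x f x =
  \int[lebn]_x \int[leb]_t f (cons_rV (t, x)).
Proof.
rewrite ge0_integral_rVS_prod fubini_tonelli2//; first exact: measurable_cons_comp.
by move=> x; exact: f0.
Qed.

Lemma measurable_integral_cons1 :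
  measurable_fun setT (fun t => \int[lebn]_x f (cons_rV (t, x))).
Proof.
apply: (@measurable_fun_fubini_tonelli_F _ _ _ _ _ lebn (f \o @cons_rV R n)) => //.
  exact: measurable_cons_comp.
by move=> x; exact: f0.
Qed.

Lemma measurable_integral_cons2 :
  measurable_fun setT (fun x => \int[leb]_t f (cons_rV (t, x))).
Proof.
apply: (@measurable_fun_fubini_tonelli_G _ _ _ _ _ leb (f \o @cons_rV R n)) => //.
  exact: measurable_cons_comp.
by move=> x; exact: f0.
Qed.

End ge0.

Section integrable.
Local Open Scope ereal_scope.
Context n (f : 'rV[R]_n.+1 -> \bar R).
Hypothesis intf : (@lebesgue_rV R n.+1).-integrable setT f.

Lemma integrable_cons_rV : (leb \x @lebesgue_rV R n).-integrable setT (f \o @cons_rV R n).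
Proof.
have mf := measurable_int _ intf.
apply/integrableP; split; first exact: measurable_cons_comp.
move/integrableP : intf => [_]; rewrite ge0_integral_rVS_prod//.
exact: measurableT_comp.
Qed.

(** Counterpart of the Tonelli formulas for partial derivatives, which change sign. *)
Lemma integral_rVS1 : \int[lebn]_x f x =
  \int[leb]_t \int[lebn]_x f (cons_rV (t, x)).
Proof.
rewrite integral_pushforward//; last 3 first.
- exact: measurable_cons_rV.
- exact: measurable_int intf.
- exact: integrable_cons_rV.
by rewrite -integral12_prod_meas1//; exact: integrable_cons_rV.
Qed.

Lemma integral_rVS2 : \int[lebn]_x f x =
  \int[lebn]_x \int[leb]_t f (cons_rV (t, x)).
Proof.
rewrite integral_rVS1.
rewrite (integral12_prod_meas1 integrable_cons_rV).
by rewrite -(integral21_prod_meas1 integrable_cons_rV).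
Qed.

End integrable.

Lemma cube_cons N n t (x : 'rV[R]_n) :
  cube N n.+1 (cons_rV (t, x)) <-> `[- N, N]%classic t /\ cube N n x.
Proof.
rewrite /= in_itv/= -ler_norml; split => [h|[tN xN] i].
  split; first by have := h ord0; rewrite cons_rV0.
  by move=> i; have := h (lift ord0 i); rewrite cons_rVS.
by case: (unliftP ord0 i) => [j|] ->; rewrite ?cons_rVS ?cons_rV0.
Qed.

Lemma lebesgue_cube (N : R) n : 0 <= N -> @lebesgue_rV R n (cube N n) = ((N *+ 2) ^+ n)%:E.
Proof.
move=> N0; elim: n => [|n ih].
  rewrite /= diracE mem_set ?expr0//; exact: cube0.
rewrite [LHS]/= /lebesgue_step /pushforward.
rewrite (_ : _ @^-1` _ = `[- N, N]%classic `*` cube N n); last first.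
  by apply/seteqP; split => -[t x] /=; rewrite cube_cons.
rewrite product_measure1E//; last exact: cube_measurable.
rewrite [X in (_ * X)%E](_ : _ = @lebesgue_rV R n (cube N n))// ih.
rewrite [X in (X * _)%E](_ : _ = leb `[- N, N]%classic)// lebesgue_measure_itv/= lte_fin.
rewrite exprS EFinM.
have [N_gt0|] := ltP 0 N.
  by rewrite ifT ?gtrN//; congr (_ * _)%E; rewrite -EFinD opprK mulr2n.
move=> N_le0; have -> : N = 0 by apply/le_anti/andP.
by rewrite oppr0 ltxx mul0rn.
Qed.

Lemma ge0_integral_cube1 (N : R) n (f : 'rV[R]_n.+1 -> \bar R) :
  measurable_fun setT f -> (forall x, 0 <= f x)%E ->
  (\int[lebn]_(x in cube N n.+1) f x =
   \int[leb]_(t in `[(- N)%R, N]) \int[lebn]_(x in cube N n) f (cons_rV (t, x)))%E.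
Proof.
move=> mf f0; rewrite integral_mkcond ge0_integral_rVS1; last 2 first.
- apply: (measurable_restrictT f (cube_measurable N (n := n.+1))).1.
  exact: measurable_funTS.
- by move=> x; rewrite patchE; case: ifP.
rewrite [RHS]integral_mkcond; apply: eq_integral => t _; rewrite [RHS]patchE.
case: ifPn => [/set_mem tN|/negP tN].
  rewrite [RHS]integral_mkcond; apply: eq_integral => x _; rewrite !patchE.
  by congr (if _ then _ else _); apply/idP/idP => /set_mem h; apply/mem_set;
    [have /cube_cons[] := h|apply/cube_cons].
apply: integral0_eq => x _; rewrite patchE; case: ifPn => // /set_mem/cube_cons[h].
by exfalso; apply: tN; apply/mem_set.
Qed.

Lemma ge0_integral_cube2 (N : R) n (f : 'rV[R]_n.+1 -> \bar R) :
  measurable_fun setT f -> (forall x, 0 <= f x)%E ->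
  (\int[lebn]_(x in cube N n.+1) f x =
   \int[lebn]_(x in cube N n) \int[leb]_(t in `[(- N)%R, N]) f (cons_rV (t, x)))%E.
Proof.
move=> mf f0; rewrite integral_mkcond ge0_integral_rVS2; last 2 first.
- apply: (measurable_restrictT f (cube_measurable N (n := n.+1))).1.
  exact: measurable_funTS.
- by move=> x; rewrite patchE; case: ifP.
rewrite [RHS]integral_mkcond; apply: eq_integral => x _; rewrite [RHS]patchE.
case: ifPn => [/set_mem xN|/negP xN].
  rewrite [RHS]integral_mkcond; apply: eq_integral => t _; rewrite !patchE.
  by congr (if _ then _ else _); apply/idP/idP => /set_mem h; apply/mem_set;
    [have /cube_cons[] := h|apply/cube_cons].
apply: integral0_eq => t _; rewrite patchE; case: ifPn => // /set_mem/cube_cons[_ h].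
by exfalso; apply: xN; apply/mem_set.
Qed.

Lemma continuous_integrable_cube N n (f : 'rV[R]_n -> R) : continuous f ->
  (lebesgue_rV n).-integrable (cube N n) (EFin \o f).
Proof.
move=> cf; have [M M0 fM] := cube_bounded N cf.
apply: measurable_bounded_integrable.
- exact: cube_measurable.
- have [N0|N0] := leP 0 N.
    by rewrite [X in (X < _)%E]lebesgue_cube// ltry.
  apply: (@le_lt_trans _ _ (lebesgue_rV n (cube 0 n))).
    rewrite le_measure ?inE//; [exact: cube_measurable..|].
    by move=> x /= xN i; apply: (le_trans (xN i)); exact: ltW.
  by rewrite [X in (X < _)%E]lebesgue_cube// ltry.
- by apply: measurable_funTS; exact: continuous_measurable_rV.
- exists M; split; first by rewrite num_real.
  by move=> y My x xN /=; apply: le_trans (ltW My); exact: fM.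
Qed.

Lemma continuous_integrable N n (f : 'rV[R]_n -> R) : continuous f ->
  (forall x, ~ cube N n x -> f x = 0) ->
  (lebesgue_rV n).-integrable setT (EFin \o f).
Proof.
move=> cf f0; have := continuous_integrable_cube N cf.
rewrite integrable_mkcond//; last exact: cube_measurable.
rewrite (_ : _ \_ _ = EFin \o f)//; apply/funext => x; rewrite patchE.
by case: ifPn => //= /negP xN; rewrite f0// => /mem_set.
Qed.

End fubini_rV.

(** * Integrals of partial derivatives *)

Section directional.
Context {R : realType}.

Lemma derive_along (U W : normedModType R) (f : U -> R) (g : W -> R) a v b w :
  (forall h, f (h *: v + a) = g (h *: w + b)) ->
  'D_v f a = 'D_w g b /\ (derivable f a v <-> derivable g b w).
Proof.
move=> fg.
have fab : f a = g b by have := fg 0; rewrite !scale0r !add0r.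
by rewrite /derive /derivable (_ : (fun h => _) = (fun h : R =>
   h^-1 *: ((g \o shift b) (h *: w) - g b)))//; apply/funext => h /=; rewrite fg fab.
Qed.

Lemma delta_mx_cons0 n : delta_mx ord0 ord0 = cons_rV (1, 0) :> 'rV[R]_n.+1.
Proof.
apply/rowP => i; rewrite mxE /=; case: (unliftP ord0 i) => [j|] ->.
  by rewrite cons_rVS mxE.
by rewrite cons_rV0.
Qed.

Lemma delta_mx_consS n (j : 'I_n) :
  delta_mx ord0 (lift ord0 j) = cons_rV (0, delta_mx ord0 j) :> 'rV[R]_n.+1.
Proof.
apply/rowP => i; rewrite mxE /=; case: (unliftP ord0 i) => [k|] ->.
  by rewrite cons_rVS mxE (inj_eq (@lift_inj _ ord0)).
by rewrite (cons_rV0 (0, delta_mx ord0 j)) (negbTE (neq_lift _ _)).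
Qed.

Lemma cons_rV_shift n (h s t : R) (x y : 'rV[R]_n) :
  h *: cons_rV (s, x) + cons_rV (t, y) = cons_rV (h * s + t, h *: x + y).
Proof.
apply/rowP => i; rewrite mxE [X in X + _]mxE.
by case: (unliftP ord0 i) => [j|] ->; rewrite ?cons_rVS ?cons_rV0 ?mxE.
Qed.

Lemma partial_cons0 n (u : 'rV[R]_n.+1 -> R) t x :
  (fun s => u (cons_rV (s, x)))^`()%classic t = partial u ord0 (cons_rV (t, x)) /\
  (derivable (fun s => u (cons_rV (s, x))) t 1 <->
   derivable u (cons_rV (t, x)) (delta_mx ord0 ord0)).
Proof.
rewrite derive1E; apply: derive_along => h.
by rewrite delta_mx_cons0 cons_rV_shift scaler0 add0r.
Qed.

Lemma partial_consS n (u : 'rV[R]_n.+1 -> R) t x j :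
  partial (fun y => u (cons_rV (t, y))) j x =
    partial u (lift ord0 j) (cons_rV (t, x)) /\
  (derivable (fun y => u (cons_rV (t, y))) x (delta_mx ord0 j) <->
   derivable u (cons_rV (t, x)) (delta_mx ord0 (lift ord0 j))).
Proof.
apply: derive_along => h.
by rewrite delta_mx_consS cons_rV_shift mulr0 add0r.
Qed.

Lemma continuous_cons1 n (u : 'rV[R]_n.+1 -> R) x :
  continuous u -> continuous (fun s => u (cons_rV (s, x))).
Proof.
move=> cu t; apply: (@continuous_comp _ _ _ (fun s => cons_rV (s, x)) u).
  by apply: (continuous_cons_rV (f := id) (g := fun=> x)) => z //; exact: cvg_cst.
exact: cu.
Qed.

Lemma continuous_cons2 n (u : 'rV[R]_n.+1 -> R) t :
  continuous u -> continuous (fun x => u (cons_rV (t, x))).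
Proof.
move=> cu x; apply: (@continuous_comp _ _ _ (fun y => cons_rV (t, y)) u).
  have ct : continuous (fun _ : 'rV[R]_n => t) by exact: cst_continuous.
  have ci : continuous (@id 'rV[R]_n) by move=> z; exact: cvg_id.
  exact: (continuous_cons_rV ct ci).
exact: cu.
Qed.

Arguments continuous_cons1 {n u} x _.
Arguments continuous_cons2 {n u} t _.

(** The cube is closed, so [u] vanishes in a whole neighbourhood of a point outside it. *)
Lemma partial_out_cube N n (u : 'rV[R]_n -> R) i :
  (forall x, ~ cube N n x -> u x = 0) ->
  forall x, ~ cube N n x -> partial u i x = 0.
Proof.
move=> u0 x xN; rewrite /partial (@near_eq_derive _ _ _ u (cst 0)) ?derive_cst//.
apply: (@filterS _ (nbhs x) _ (~` cube N n)); first by move=> y /u0.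
apply: open_nbhs_nbhs; split => //; apply: closed_openC.
by apply: compact_closed; [exact: norm_hausdorff|exact: cube_compact].
Qed.

Lemma continuous_FTC2_line (F f : R -> R) (a b : R) : a < b ->
  (forall x : R, is_derive x (1 : R) F (f x)) -> continuous f ->
  (\int[lebesgue_measure]_(x in `[a, b]) (f x)%:E = (F b)%:E - (F a)%:E)%E.
Proof.
move=> ab dF cf.
have cF : continuous F.
  move=> x; apply/differentiable_continuous/derivable1_diffP.
  by have [] := dF x.
apply: continuous_FTC2 => //.
- exact: continuous_subspaceT.
- split.
  + by move=> x _; have [] := dF x.
  + by apply: cvg_at_right_filter; exact: cF.
  + by apply: cvg_at_left_filter; exact: cF.
- by move=> x _; rewrite derive1E; have [] := dF x.
Qed.

(** Induction on the dimension. A derivative in a later coordinate is a derivative on the slices, so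
    the first coordinate is integrated last; a derivative in the first coordinate is integrated
    first, where it yields boundary values off the support. *)
Lemma integral_partial n (u : 'rV[R]_n -> R) i N :
  (forall x, derivable u x (delta_mx ord0 i)) -> continuous (partial u i) ->
  (forall x, ~ cube N n x -> u x = 0) ->
  (\int[lebesgue_rV n]_x (partial u i x)%:E = 0)%E.
Proof.
move=> du cu u0; have u'0 := partial_out_cube i u0.
have intu := continuous_integrable cu u'0.
elim: n u i du cu u0 u'0 intu => [|n ih] u i du cu u0 u'0 intu; first by case: i du cu u'0 intu.
case: (unliftP ord0 i) du cu u'0 intu => [j|] -> du cu u'0 intu.
- rewrite (@integral_rVS1 _ _ (EFin \o partial u (lift ord0 j)))//.
  apply: integral0_eq => t _.
  under eq_integral do rewrite /= -(partial_consS u t _ j).1.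
  have pE : partial (fun y => u (cons_rV (t, y))) j =
      (fun x => partial u (lift ord0 j) (cons_rV (t, x))).
    by apply/funext => x; rewrite (partial_consS u t _ j).1.
  have u0' x : ~ cube N n x -> u (cons_rV (t, x)) = 0.
    by move=> xN; apply: u0 => /cube_cons[].
  have cu' : continuous (partial (fun y => u (cons_rV (t, y))) j).
    by rewrite pE; exact: continuous_cons2.
  apply: ih => //.
  + by move=> x; apply/(partial_consS u t _ j).2.
  + exact: partial_out_cube.
  + exact: (continuous_integrable cu' (partial_out_cube j u0')).
- rewrite (@integral_rVS2 _ _ (EFin \o partial u ord0))//.
  apply: integral0_eq => x _.
  (* Strictly larger than [N], and positive even if [N] is negative: the interval is nondegenerate
     and [u] vanishes at both of its ends. *)
  pose M : R := `|N| + 1.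
  have NM t : ~ `[- M, M]%classic t -> ~ cube N n.+1 (cons_rV (t, x)).
    move=> tM /cube_cons[+ _]; apply: contra_not tM => /=.
    rewrite !in_itv/= -!ler_norml => /le_trans; apply.
    by rewrite /M (le_trans (ler_norm N))// lerDl.
  have M0 : - M < M by rewrite gtrN// /M ltr_wpDl.
  transitivity (\int[lebesgue_measure]_(t in `[(- M)%R, M])
      (partial u ord0 (cons_rV (t, x)))%:E)%E.
    rewrite [RHS]integral_mkcond; apply: eq_integral => t _; rewrite patchE.
    by case: ifPn => //= /negP tM; rewrite u'0// => /NM; apply => tM'; apply/tM/mem_set.
  have dux (t : R) : is_derive t (1 : R) (fun t => u (cons_rV (t, x)))
      (partial u ord0 (cons_rV (t, x))).
    rewrite -(partial_cons0 u t x).1 derive1E; apply: DeriveDef => //.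
    by apply/(partial_cons0 u t x).2.
  rewrite (continuous_FTC2_line M0 dux (continuous_cons1 x cu)).
  have uN t : `|N| < `|t| -> u (cons_rV (t, x)) = 0.
    move=> Nt; apply: u0 => /cube_cons[+ _]; rewrite /= in_itv/= -ler_norml.
    by apply/negP; rewrite -ltNge; apply: le_lt_trans Nt; exact: ler_norm.
  have NM' : `|N| < `|M| by rewrite [ltRHS]ger0_norm ?ltrDl// /M addr_ge0.
  by rewrite !uN ?normrN// sube0.
Qed.

End directional.

Arguments continuous_cons1 {R n u} x _.
Arguments continuous_cons2 {R n u} t _.

(** * Poincare inequality on a cube *)

Section poincare.
Context {R : realType}.
Local Notation leb := (@lebesgue_measure R).
Local Notation lebn := (@lebesgue_rV R _).

Lemma Ck1_cons n (h : 'rV[R]_n.+1 -> R) t :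
  Ck 1 h -> Ck 1 (fun x => h (cons_rV (t, x))).
Proof.
move=> [ch dh]; split; first exact: continuous_cons2.
move=> i; have [di ci] := dh (lift ord0 i); split.
  by move=> x; apply/(partial_consS h t x i).2.
rewrite (_ : partial _ i = fun x => partial h (lift ord0 i) (cons_rV (t, x))).
  exact: continuous_cons2.
by apply/funext => x; rewrite (partial_consS h t x i).1.
Qed.

Lemma continuous_sqr (T : topologicalType) (f : T -> R) :
  continuous f -> continuous (fun x => f x ^+ 2).
Proof. by move=> cf x; apply: cvgM; exact: cf. Qed.

Lemma continuous_subr_cst (T : topologicalType) (f : T -> R) c :
  continuous f -> continuous (fun x => f x - c).
Proof. by move=> cf x; apply: cvgB; [exact: cf|exact: cvg_cst]. Qed.

Lemma continuous_sum (T : topologicalType) (I : Type) (r : seq I)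
    (F : I -> T -> R) : (forall i, continuous (F i)) ->
  continuous (fun x => \sum_(i <- r) F i x).
Proof.
move=> cF; elim: r => [|i r ih].
  by under eq_fun do rewrite big_nil; exact: cst_continuous.
under eq_fun do rewrite big_cons.
by move=> x; apply: cvgD; [exact: cF|exact: ih].
Qed.

(* The integral of [(g' - m)^2] is nonnegative, where m is the mean of g'. *)
Lemma increment_sqr_le (g g' : R -> R) (N s t : R) :
  (forall x : R, is_derive x (1 : R) g (g' x)) -> continuous g' ->
  s \in `[- N, N] -> t \in `[- N, N] ->
  (((g s - g t) ^+ 2)%:E <= (N *+ 2)%:E * \int[leb]_(x in `[(- N)%R, N]) (g' x ^+ 2)%:E)%E.
Proof.
move=> dg cg'; wlog st : s t / t < s => [hw|].
  move=> sN tN; case: (ltgtP s t) => [st|st|->].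
  - by rewrite -sqrrN opprB; exact: hw.
  - exact: hw.
  - rewrite subrr expr0n/= mule_ge0//.
      by move: tN; rewrite in_itv/= lee_fin; lra.
    by apply: integral_ge0 => x _; rewrite lee_fin sqr_ge0.
rewrite !in_itv/= => /andP[Ns sN] /andP[Nt tN].
pose m := (g s - g t) / (s - t).
have st0 : s - t != 0 by rewrite subr_eq0 gt_eqF.
(* Expanding the square, [g'^2] is bounded below by [2 m g' - m^2], which has an explicit primitive;
   its increment from [t] to [s] is [m^2 (s - t)]. *)
have dG (x : R) : is_derive x (1 : R) (fun x => m *+ 2 * g x - m ^+ 2 * x)
    (m *+ 2 * g' x - m ^+ 2).
  apply: is_derive_eq; rewrite /GRing.scale/= mulr1; congr (_ - _); ring.
have cm : continuous (fun x => m *+ 2 * g' x - m ^+ 2).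
  move=> x; apply: cvgB; last exact: cvg_cst.
  by apply: cvgM; [exact: cvg_cst|exact: cg'].
have cg2 : continuous (fun x => g' x ^+ 2) by exact: continuous_sqr.
have int1 (a b : R) (u : R -> R) : continuous u -> leb.-integrable `[a, b] (EFin \o u).
  by move=> cu; apply: continuous_compact_integrable;
    [exact: segment_compact|exact: continuous_subspaceT].
have m2 : m ^+ 2 * (s - t) = m *+ 2 * g s - m ^+ 2 * s - (m *+ 2 * g t - m ^+ 2 * t).
  have -> : g s = m * (s - t) + g t by rewrite /m divfK// subrK.
  ring.
have : ((m ^+ 2 * (s - t))%:E <= \int[leb]_(x in `[t, s]) (g' x ^+ 2)%:E)%E.
  rewrite m2 EFinB -(continuous_FTC2_line st dG cm).
  apply: le_integral => //; [exact: int1|exact: int1|].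
  move=> x _; rewrite lee_fin; have := sqr_ge0 (g' x - m); lra.
move=> mle; have -> : (g s - g t) ^+ 2 = (s - t) * (m ^+ 2 * (s - t)).
  by rewrite /m; field.
rewrite EFinM; apply: lee_pmul => //.
- by rewrite lee_fin subr_ge0 ltW.
- by rewrite lee_fin mulr_ge0 ?sqr_ge0// subr_ge0 ltW.
- by rewrite lee_fin; lra.
apply: (le_trans mle); apply: ge0_subset_integral => //.
- apply/measurable_EFinP/measurable_funTS; apply: continuous_measurable_fun.
  exact: cg2.
- by move=> x _; rewrite lee_fin sqr_ge0.
- by move=> x /=; rewrite !in_itv/= => /andP[tx xs]; apply/andP; split; lra.
Qed.

Lemma measurable_integral_cube1 N n (f : 'rV[R]_n.+1 -> \bar R) :
  measurable_fun setT f -> (forall x, 0 <= f x)%E ->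
  measurable_fun setT (fun t => \int[lebn]_(x in cube N n) f (cons_rV (t, x)))%E.
Proof.
move=> mf f0.
(* Restricting [f] to this cylinder turns the integral over the cube into one over the whole slice,
   whose measurability is part of Tonelli's theorem. *)
pose B := [set p : 'rV[R]_n.+1 | cube N n (uncons_rV p).2].
have mB : measurable B.
  rewrite (_ : B = (snd \o @uncons_rV R n) @^-1` cube N n)//.
  rewrite -[X in measurable X]setTI; have ms : measurable_fun setT (snd \o @uncons_rV R n).
    by apply: measurableT_comp => //; exact: measurable_uncons_rV.
  by apply: ms => //; exact: cube_measurable.
rewrite (_ : (fun t => _) = fun t => \int[lebn]_x (f \_ B) (cons_rV (t, x)))%E.
  apply: measurable_integral_cons1.
    apply: (measurable_restrictT f mB).1; exact: measurable_funTS.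
  by move=> x; rewrite patchE; case: ifP.
apply/funext => t; rewrite integral_mkcond; apply: eq_integral => x _.
rewrite !patchE /B; congr (if _ then _ else _).
have xE : (uncons_rV (cons_rV (t, x))).2 = x by rewrite cons_rVK.
apply/idP/idP => /set_mem h; apply/mem_set; first by rewrite /mkset xE.
by move: h; rewrite /mkset xE.
Qed.

Lemma measurable_integral_cube2 N n (f : 'rV[R]_n.+1 -> \bar R) :
  measurable_fun setT f -> (forall x, 0 <= f x)%E ->
  measurable_fun setT (fun x => \int[leb]_(t in `[(- N)%R, N]) f (cons_rV (t, x)))%E.
Proof.
move=> mf f0.
pose B := [set p : 'rV[R]_n.+1 | `[(- N)%R, N]%classic (p ord0 ord0)].
have mB : measurable B.
  rewrite (_ : B = (fun p : 'rV[R]_n.+1 => p ord0 ord0) @^-1` `[(- N)%R, N]%classic)//.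
  by rewrite -[X in measurable X]setTI; apply: measurable_coord.
rewrite (_ : (fun t => _) = fun x => \int[leb]_t (f \_ B) (cons_rV (t, x)))%E.
  apply: measurable_integral_cons2.
    apply: (measurable_restrictT f mB).1; exact: measurable_funTS.
  by move=> x; rewrite patchE; case: ifP.
apply/funext => t; rewrite integral_mkcond; apply: eq_integral => x _.
rewrite !patchE /B; congr (if _ then _ else _).
apply/idP/idP => /set_mem h; apply/mem_set; first by rewrite /mkset cons_rV0.
by move: h; rewrite /mkset cons_rV0.
Qed.

(** The slack [e] reduces the claim to a comparison of integrals: if [E] exceeded the bound on the
    whole interval, its integral would be at least [T + e]. *)
Lemma exists_le_average (N T e : R) (E : R -> \bar R) : 0 < N -> 0 < e ->
  measurable_fun setT E -> (forall t, 0 <= E t)%E ->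
  (\int[leb]_(t in `[(- N)%R, N]) E t <= T%:E)%E ->
  exists2 t, t \in `[- N, N] & (E t <= ((T + e) / (N *+ 2))%:E)%E.
Proof.
move=> N0 e0 mE E0 ET; apply: contrapT => nex.
have T0 : 0 <= T.
  by rewrite -lee_fin; apply: le_trans ET; exact: integral_ge0.
have : ((T + e)%:E <= T%:E)%E.
  apply: le_trans ET.
  apply: (@le_trans _ _ (\int[leb]_(t in `[(- N)%R, N]) ((T + e) / (N *+ 2))%:E)%E).
    rewrite integral_cst//= lebesgue_measure_itv/= lte_fin gtrN// -EFinD -EFinM.
    by rewrite lee_fin opprK -mulr2n divfK// mulrn_eq0/= gt_eqF.
  apply: ge0_le_integral => //.
  - by move=> t _; rewrite lee_fin divr_ge0// ?mulrn_wge0// ?ltW//; lra.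
  - exact: measurable_funTS.
  - move=> t tN; rewrite leNgt; apply/negP => lt; apply: nex; exists t => //.
    exact: ltW.
by rewrite lee_fin; lra.
Qed.

Lemma lebesgue_itv_sym (N : R) : 0 <= N -> leb `[(- N)%R, N] = (N *+ 2)%:E.
Proof.
rewrite le_eqVlt => /predU1P[<-|N0]; first by rewrite oppr0 set_itv1 lebesgue_measure_set1 mul0rn.
by rewrite lebesgue_measure_itv/= lte_fin gtrN// -EFinD opprK.
Qed.

Lemma integral_cst_sym (N : R) (x : \bar R) : 0 <= N ->
  (\int[leb]_(_ in `[(- N)%R, N]) x = x * (N *+ 2)%:E)%E.
Proof. by move=> N0; rewrite integral_cst//; congr (_ * _)%E; exact: lebesgue_itv_sym. Qed.

Lemma lee_affine (k m e : R) (x : \bar R) : 0 <= k -> (0 <= x)%E ->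
  (x <= m%:E)%E -> (k%:E * x + e%:E <= (k * m + e)%:E)%E.
Proof.
move=> k0; case: x => [x| |]// _.
by rewrite !lee_fin => xm; rewrite lerD2r ler_wpM2l.
Qed.

(** The factor [N *+ 2] is the length of the interval over which the pointwise bound [4 N A + 2 q]
    of the Poincare inequality is integrated. *)
Lemma slice_bound_scale (N r : R) (x : \bar R) : 0 < N -> (0 <= x)%E ->
  ((N ^+ 2 *+ 8)%:E * x + (N *+ 4)%:E * r%:E =
   ((N *+ 4)%:E * x + (r *+ 2)%:E) * (N *+ 2)%:E)%E.
Proof.
move=> N0; case: x => [x| |]// _.
  apply: (congr1 EFin (_ : N ^+ 2 *+ 8 * x + N *+ 4 * r = (N *+ 4 * x + r *+ 2) * (N *+ 2))).
  by ring.
by rewrite !gt0_muley ?lte_fin ?pmulrn_lgt0 ?exprn_gt0// -!EFinM !addye// gt0_mulye// lte_fin pmulrn_lgt0.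
Qed.

(* By induction on n: c is the constant of a slice whose energy is at most the
   average up to an error, which e pays for. *)
Lemma poincare_cube (N : R) n : 0 < N -> exists2 K : R, 0 < K &
  forall h : 'rV[R]_n -> R, Ck 1 h -> forall e : R, 0 < e -> exists c : R,
  (\int[lebn]_(x in cube N n) ((h x - c) ^+ 2)%:E <=
   K%:E * \int[lebn]_(x in cube N n) (\sum_i partial h i x ^+ 2)%:E + e%:E)%E.
Proof.
move=> N0; elim: n => [|n [K K0 ih]].
  (* In dimension 0 the cube is a point and [h] is constant. *)
  exists 1 => // h _ e e0; exists (h 0).
  rewrite integral0_eq ?mul1e.
    apply: adde_ge0; last by rewrite lee_fin ltW.
    by apply: integral_ge0 => x _; rewrite lee_fin sumr_ge0// => i _; rewrite sqr_ge0.
  move=> x _; rewrite (_ : x = 0) ?subrr ?expr0n//; exact: thinmx0.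
(* The part [8 N^2] bounds the oscillation along the first coordinate. The part [2 K] is
   [4 N K / (2 N)]: the induction hypothesis on one slice, weighted by [4 N], for a slice of nearly
   average energy. *)
exists (N ^+ 2 *+ 8 + K *+ 2) => [|h hC e e0].
  by rewrite addr_gt0// pmulrn_lgt0// exprn_gt0.
have [ch dh] := hC.
have cp i : continuous (partial h i) by have [] := dh i.
pose g x := \sum_(j < n) partial h (lift ord0 j) x ^+ 2.
pose p0 x := partial h ord0 x ^+ 2.
have cg : continuous g by apply: continuous_sum => j; exact/continuous_sqr/cp.
have cp0 : continuous p0 by exact/continuous_sqr/cp.
have g0 x : 0 <= g x by apply: sumr_ge0 => j _; exact: sqr_ge0.
have p00 x : 0 <= p0 x by exact: sqr_ge0.
have mg : measurable_fun setT (EFin \o g).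
  by apply/measurable_EFinP; exact: continuous_measurable_rV.
have mp0 : measurable_fun setT (EFin \o p0).
  by apply/measurable_EFinP; exact: continuous_measurable_rV.
have := integrable_fin_num (cube_measurable N (n := n.+1)) (continuous_integrable_cube N cg).
have := integrable_fin_num (cube_measurable N (n := n.+1)) (continuous_integrable_cube N cp0).
set PE := (\int[_]_(x in _) _)%E; set TE := (\int[_]_(x in _) _)%E.
move=> /fineK PEE /fineK TEE; set P := fine PE in PEE; set T := fine TE in TEE.
have sumE : (\int[lebn]_(x in cube N n.+1) (\sum_i partial h i x ^+ 2)%:E = (P + T)%:E)%E.
  under eq_integral do rewrite big_ord_recl EFinD.
  rewrite ge0_integralD//.
  - by rewrite EFinD PEE TEE.
  - exact: cube_measurable.
  - by move=> x _; rewrite lee_fin p00.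
  - exact: measurable_funTS mp0.
  - by move=> x _; rewrite lee_fin g0.
  - exact: measurable_funTS mg.
rewrite sumE.
pose E t := (\int[lebn]_(x in cube N n) (g (cons_rV (t, x)))%:E)%E.
(* This error is later multiplied by [4 N K / (2 N) = 2 K], and the error [e / (8 N)] given to the
   induction hypothesis by [4 N]: each contributes [e / 2]. *)
have [||||t tN Et] := @exists_le_average N T (e / (K *+ 4)) E N0.
- by rewrite divr_gt0// pmulrn_lgt0.
- exact: (@measurable_integral_cube1 N n (EFin \o g)).
- by move=> t; apply: integral_ge0 => x _; rewrite lee_fin.
- by rewrite TEE /TE ge0_integral_cube1.
have [|c hc] := ih _ (Ck1_cons t hC) (e / (N *+ 8)).
  by rewrite divr_gt0// pmulrn_lgt0.
exists c.
pose A x := (\int[leb]_(r in `[(- N)%R, N]) (p0 (cons_rV (r, x)))%:E)%E.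
have mA : measurable_fun setT A by exact: (@measurable_integral_cube2 N n (EFin \o p0)).
have A0 x : (0 <= A x)%E by apply: integral_ge0 => r _; rewrite lee_fin.
pose q x := (h (cons_rV (t, x)) - c) ^+ 2.
have cq : continuous q.
  by apply: continuous_sqr; apply: continuous_subr_cst; exact: (continuous_cons2 t ch).
have q0 x : 0 <= q x by exact: sqr_ge0.
have mq : measurable_fun setT (EFin \o q).
  by apply/measurable_EFinP; exact: continuous_measurable_rV.
have chc : continuous (fun x => (h x - c) ^+ 2).
  by apply: continuous_sqr; exact: continuous_subr_cst.
have mhc : measurable_fun setT (fun x => ((h x - c) ^+ 2)%:E).
  by apply/measurable_EFinP; exact: continuous_measurable_rV.
rewrite ge0_integral_cube2//; last by move=> x; rewrite lee_fin sqr_ge0.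
apply: (@le_trans _ _ (\int[lebn]_(x in cube N n)
    ((N ^+ 2 *+ 8)%:E * A x + (N *+ 4)%:E * (q x)%:E))%E).
  apply: ge0_le_integral.
  - exact: cube_measurable.
  - by move=> x _; apply: integral_ge0 => s _; rewrite lee_fin sqr_ge0.
  - apply: measurable_funTS; apply: (@measurable_integral_cube2 N n (fun x => ((h x - c) ^+ 2)%:E)) => //.
    by move=> x; rewrite lee_fin sqr_ge0.
  - by apply: measurable_funTS; apply: emeasurable_funD; apply: measurable_funeM.
  - move=> x _.
    have -> : ((N ^+ 2 *+ 8)%:E * A x + (N *+ 4)%:E * (q x)%:E =
       \int[leb]_(s in `[(- N)%R, N]) ((N *+ 4)%:E * A x + (q x *+ 2)%:E))%E.
      by rewrite (integral_cst_sym _ (ltW N0)); exact: slice_bound_scale.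
    apply: ge0_le_integral => //.
    + by move=> s _; rewrite lee_fin sqr_ge0.
    + apply: measurable_funTS; apply/measurable_EFinP; apply: continuous_measurable_fun.
      exact: (continuous_cons1 x chc).
    + move=> s sN.
      have := @increment_sqr_le (fun s => h (cons_rV (s, x)))
         (fun s => partial h ord0 (cons_rV (s, x))) N s t.
      have -> : (\int[leb]_(r in `[(- N)%R, N]) (partial h ord0 (cons_rV (r, x)) ^+ 2)%:E)%E = A x by [].
      move=> /(_ _ _ sN tN); move: (A0 x); case: (A x) => [Ax| |]//.
        move=> _ inc; rewrite -!EFinM -EFinD lee_fin.
        have {}inc : (h (cons_rV (s, x)) - h (cons_rV (t, x))) ^+ 2 <= N *+ 2 * Ax.
          rewrite -lee_fin EFinM; apply: inc.
            move=> r; have [rE rd] := partial_cons0 h r x; rewrite -rE derive1E.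
            by apply: DeriveDef => //; apply/rd; have [] := dh ord0.
          exact: (continuous_cons1 x (cp ord0)).
        rewrite /q; set a1 := h (cons_rV (s, x)) in inc *; set b1 := h (cons_rV (t, x)) in inc *.
        (* This is [(u + v)^2 <= 2 u^2 + 2 v^2], with [u] the increment from [t] to [s] along the
           first coordinate and [v] the deviation from [c] on the chosen slice. *)
        have := sqr_ge0 ((a1 - b1) - (b1 - c)).
        rewrite (_ : N *+ 4 * Ax = (N *+ 2 * Ax) *+ 2); last by ring.
        move: inc; lra.
      by move=> _ _; rewrite gt0_muley ?lte_fin ?pmulrn_lgt0// addye ?leey// -EFinM.
rewrite ge0_integralD; last 5 first.
- exact: cube_measurable.
- by move=> x _; rewrite mule_ge0// lee_fin mulrn_wge0// sqr_ge0.
- by apply: measurable_funTS; apply: measurable_funeM.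
- by move=> x _; rewrite -EFinM lee_fin mulr_ge0// mulrn_wge0// ltW.
- by apply: measurable_funTS; apply: measurable_funeM.
have N80 : (0 <= (N ^+ 2 *+ 8)%:E :> \bar R)%E by rewrite lee_fin mulrn_wge0// sqr_ge0.
have N40 : (0 <= (N *+ 4)%:E :> \bar R)%E by rewrite lee_fin mulrn_wge0// ltW.
have mQ := cube_measurable N (n := n).
have mA' := measurable_funTS (D := cube N n) mA.
have mq' := measurable_funTS (D := cube N n) mq.
have -> : (\int[lebn]_(x in cube N n) ((N ^+ 2 *+ 8)%:E * A x) =
    (N ^+ 2 *+ 8)%:E * \int[lebn]_(x in cube N n) A x)%E by rewrite ge0_integralZl.
have -> : (\int[lebn]_(x in cube N n) ((N *+ 4)%:E * (q x)%:E) =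
    (N *+ 4)%:E * \int[lebn]_(x in cube N n) (q x)%:E)%E.
  by apply: (@ge0_integralZl _ _ _ _ _ mQ (EFin \o q)) => // x _; rewrite lee_fin.
have -> : (\int[lebn]_(x in cube N n) A x = P%:E)%E by rewrite PEE /PE ge0_integral_cube2.
have {}hc : (\int[lebn]_(x in cube N n) (q x)%:E <= (K * ((T + e / (K *+ 4)) / (N *+ 2)) + e / (N *+ 8))%:E)%E.
  have EtE : (\int[lebn]_(x in cube N n)
      (\sum_i partial (fun y => h (cons_rV (t, y))) i x ^+ 2)%:E)%E = E t.
    apply: eq_integral => x _; congr EFin; apply: eq_bigr => j _.
    by rewrite (partial_consS h t x j).1.
  apply: (le_trans hc); rewrite EtE.
  have Et0 : (0 <= E t)%E by apply: integral_ge0 => x _; rewrite lee_fin.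
  exact: lee_affine (ltW K0) Et0 Et.
apply: (@le_trans _ _ ((N ^+ 2 *+ 8)%:E * P%:E + (N *+ 4)%:E *
   (K * ((T + e / (K *+ 4)) / (N *+ 2)) + e / (N *+ 8))%:E)%E).
  apply: leeD2l; apply: lee_pmul => //; apply: integral_ge0 => x _; rewrite lee_fin; exact: q0.
rewrite -!EFinM -!EFinD lee_fin.
have -> : N *+ 4 * (K * ((T + e / (K *+ 4)) / (N *+ 2)) + e / (N *+ 8)) = K *+ 2 * T + e.
  by field; rewrite !gt_eqF.
have P0 : 0 <= P by rewrite fine_ge0//; apply: integral_ge0 => x _; rewrite lee_fin.
have T0 : 0 <= T by rewrite fine_ge0//; apply: integral_ge0 => x _; rewrite lee_fin.
(* The stated bound applies the sum of the two constants to [P + T]; the cross terms [N^2 T] and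
   [K P] are a nonnegative surplus. *)
have := mulr_ge0 (sqr_ge0 N) T0; have := mulr_ge0 (ltW K0) P0.
rewrite mulrDl !mulrDr; lra.
Qed.

End poincare.

(** * Suprema over spheres *)

Section spheres.
Context {R : realType} {d : nat}.
Implicit Types (x u v : 'rV[R]_d) (G : 'rV[R]_d -> R).

Lemma innerZl (c : R) u v : inner (c *: u) v = c * inner u v.
Proof.
by rewrite /inner mulr_sumr; apply: eq_bigr => i _; rewrite !mxE mulrA.
Qed.

Lemma innerZr (c : R) u v : inner u (c *: v) = c * inner u v.
Proof.
by rewrite /inner mulr_sumr; apply: eq_bigr => i _; rewrite !mxE mulrCA.
Qed.

Lemma inner_ge0 u : 0 <= inner u u.
Proof. by apply: sumr_ge0 => i _; rewrite -expr2 sqr_ge0. Qed.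

Lemma enorm_sqr u : enorm u ^+ 2 = inner u u.
Proof. by rewrite sqr_sqrtr ?inner_ge0. Qed.

Lemma enorm_ge0 u : 0 <= enorm u.
Proof. exact: sqrtr_ge0. Qed.

Lemma enormZ (c : R) u : 0 <= c -> enorm (c *: u) = c * enorm u.
Proof.
move=> c0; rewrite /enorm innerZl innerZr mulrA -expr2 sqrtrM ?sqr_ge0//.
by rewrite sqrtr_sqr ger0_norm.
Qed.

Lemma coord_le_enorm u i : `|u ord0 i| <= enorm u.
Proof.
rewrite -(@ler_pXn2r _ 2)// ?nnegrE ?enorm_ge0// enorm_sqr real_normK ?num_real//.
rewrite /inner (bigD1 i)//= -expr2 lerDl sumr_ge0// => j _.
by rewrite -expr2 sqr_ge0.
Qed.

Lemma continuous_inner_self : continuous (fun x => inner x x).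
Proof.
apply: continuous_sum => i; exact: continuous_sqr (@continuous_coord R d i).
Qed.

Lemma continuous_enorm : continuous (@enorm R d).
Proof.
move=> x; apply: (@continuous_comp _ _ _ (fun x => inner x x) Num.sqrt).
  exact: continuous_inner_self.
exact: sqrt_continuous.
Qed.

Lemma sphere_sub_cube r : @sphere R d r `<=` cube r d.
Proof. by move=> x <- i; exact: coord_le_enorm. Qed.

Lemma sphere_compact r : compact (@sphere R d r).
Proof.
apply: (subclosed_compact _ (@cube_compact R r d) (@sphere_sub_cube r)).
rewrite (_ : sphere r = @enorm R d @^-1` [set r])//.
apply: preimage_closed; last exact: closed_eq.
by move=> x _; exact: continuous_enorm.
Qed.

Lemma sphere_neq0 r : (0 < d)%N -> 0 <= r -> @sphere R d r !=set0.
Proof.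
move=> d0 r0; exists (r *: delta_mx ord0 (Ordinal d0)).
rewrite /sphere /= enormZ// (_ : enorm _ = 1) ?mulr1//.
rewrite /enorm /inner (bigD1 (Ordinal d0))//= big1 => [|i id].
  by rewrite !mxE !eqxx mulr1 addr0 sqrtr1.
by rewrite !mxE (negbTE id) andbF mul0r.
Qed.

Lemma sphereZ r : 0 < r -> @sphere R d r = (fun u => r *: u) @` sphere 1.
Proof.
move=> r0; apply/seteqP; split => [x xr|_ [u u1 <-]]; last first.
  by rewrite /sphere /= enormZ ?ltW// u1 mulr1.
exists (r^-1 *: x); last by rewrite scalerA divff ?gt_eqF// scale1r.
by rewrite /sphere /= enormZ ?invr_ge0 ?ltW// xr mulVf// gt_eqF.
Qed.

End spheres.

(* By compactness of the unit sphere, G (s u) tends to G (r u) as s tends to r,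
   uniformly for |u| = 1. *)
Section sphere_sup.
Context {R : realType} {d : nat} (hd : (0 < d)%N).
Variable G : 'rV[R]_d -> R.
Hypothesis cG : forall x : 'rV[R]_d, x != 0 -> {for x, continuous G}.

Lemma sphere_ubound (r : R) : 0 < r -> has_ubound [set G x | x in sphere r].
Proof.
move=> r0; have [|c _ cmax] := @compact_EVT_max _ _ G _ (sphere_neq0 hd (ltW r0)) (@sphere_compact R d r).
  apply: continuous_in_subspaceT => x /set_mem xr; apply: cG.
  apply: contraTneq r0 => x0; rewrite -xr x0.
  by rewrite /enorm /inner big1 ?sqrtr0 ?ltxx// => i _; rewrite mxE mul0r.
by exists (G c) => _ [x xr <-]; apply: cmax; exact/mem_set.
Qed.

Lemma sphere_sup_attained (r : R) : 0 < r ->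
  exists2 c, sphere r c & sup [set G x | x in sphere r] = G c.
Proof.
move=> r0; have [|c cr cmax] := @compact_EVT_max _ _ G _ (sphere_neq0 hd (ltW r0)) (@sphere_compact R d r).
  apply: continuous_in_subspaceT => x /set_mem xr; apply: cG.
  apply: contraTneq r0 => x0; rewrite -xr x0.
  by rewrite /enorm /inner big1 ?sqrtr0 ?ltxx// => i _; rewrite mxE mul0r.
exists c; first exact/set_mem.
apply/le_anti/andP; split.
  apply: ge_sup; first by exists (G c), c => //; exact/set_mem.
  by move=> _ [x xr <-]; apply: cmax; exact/mem_set.
by apply: ub_le_sup; [exact: sphere_ubound|exists c => //; exact/set_mem].
Qed.

Lemma sphere_uniform (r e : R) : 0 < r -> 0 < e ->
  \forall s \near r, forall u, sphere 1 u -> `|G (r *: u) - G (s *: u)| < e.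
Proof.
move=> r0 e0; have := @sphere_compact R d 1 => /compact_near_coveringP nc.
apply: (nc _ (nbhs r) (fun s u => `|G (r *: u) - G (s *: u)| < e)) => u u1.
have ru0 : r *: u != 0.
  rewrite scaler_eq0 negb_or gt_eqF//=; apply: contra_eq_neq u1 => ->.
  rewrite /enorm /inner big1 ?sqrtr0 ?(eq_sym 0) ?oner_eq0// => i _; by rewrite mxE mul0r.
have cm : (fun p : R * 'rV[R]_d => G (p.1 *: p.2)) @ (r, u) --> G (r *: u).
  apply: (@cvg_comp _ _ _ (fun p : R * 'rV[R]_d => p.1 *: p.2) G _ (nbhs (r *: u))).
    by apply: cvgZ; [exact: cvg_fst|exact: cvg_snd].
  exact: cG.
have cr : (fun p : 'rV[R]_d * R => G (r *: p.1)) @ (u, r) --> G (r *: u).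
  apply: (@cvg_comp _ _ _ (fun p : 'rV[R]_d * R => r *: p.1) G _ (nbhs (r *: u))).
    by apply: cvgZr; exact: cvg_fst.
  exact: cG.
have cs : (fun p : 'rV[R]_d * R => G (p.2 *: p.1)) @ (u, r) --> G (r *: u).
  apply: (@cvg_comp _ _ _ (fun p : 'rV[R]_d * R => p.2 *: p.1) G _ (nbhs (r *: u))).
    by apply: cvgZ; [exact: cvg_snd|exact: cvg_fst].
  exact: cG.
have : (fun p : 'rV[R]_d * R => G (r *: p.1) - G (p.2 *: p.1)) @ (u, r) --> (0 : R).
  by rewrite -(subrr (G (r *: u))); apply: cvgB.
move=> /cvgrPdist_lt/(_ e e0); apply: filterS => -[v s] /=.
by rewrite sub0r normrN.
Qed.

Lemma continuous_sphere_sup (r : R) : 0 < r ->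
  {for r, continuous (fun r => sup [set G x | x in sphere r])}.
Proof.
move=> r0; apply/cvgrPdist_le => e e0.
have s0 : \forall s \near r, 0 < s by exact: lt_nbhsr.
near=> s.
have sp : 0 < s by near: s.
have unif : forall u, sphere 1 u -> `|G (r *: u) - G (s *: u)| < e.
  by near: s; exact: sphere_uniform.
(* Points of the two spheres are paired along rays. The statement is used in both directions, which
   is why the radii are variables. *)
have key p q : 0 < p -> 0 < q ->
    (forall u, sphere 1 u -> `|G (p *: u) - G (q *: u)| < e) ->
    sup [set G x | x in sphere p] <= sup [set G x | x in sphere q] + e.
  move=> p0 q0 pq; apply: ge_sup.
    by have [x xp] := sphere_neq0 hd (ltW p0); exists (G x), x.
  move=> _ [x + <-]; rewrite (sphereZ p0) => -[u u1 <-].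
  have := pq u u1; rewrite ltr_norml => /andP[_ h].
  apply: (@le_trans _ _ (G (q *: u) + e)); first by rewrite -lerBlDl ltW.
  rewrite lerD2r; apply: ub_le_sup; first exact: sphere_ubound.
  by exists (q *: u) => //; rewrite (sphereZ q0); exists u.
have k1 := key r s r0 sp unif.
have k2 : sup [set G x | x in sphere s] <= sup [set G x | x in sphere r] + e.
  by apply: key => // u u1; rewrite distrC unif.
by rewrite ler_norml; lra.
Unshelve. all: by end_near. Qed.

End sphere_sup.

(** * The radial Riccati inequality *)

Section primitive.
Context {R : realType}.
Local Notation leb := (@lebesgue_measure R).
Implicit Types (phi w : R -> R).

Lemma continuous_integrable_itv phi (a b : R) : continuous phi ->
  leb.-integrable `[a, b] (EFin \o phi).
Proof.
by move=> cphi; apply: continuous_compact_integrable;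
  [exact: segment_compact|exact: continuous_subspaceT].
Qed.

Lemma Rintegral_chasles phi (a b c : R) : continuous phi -> a <= b -> b <= c ->
  \int[leb]_(t in `[a, c]) phi t =
  \int[leb]_(t in `[a, b]) phi t + \int[leb]_(t in `[b, c]) phi t.
Proof.
move=> cphi ab bc.
have -> : \int[leb]_(t in `[b, c]) phi t = \int[leb]_(t in `]b, c]) phi t.
  rewrite Rintegral_itv_obnd_cbnd//.
  apply: integrableS (continuous_integrable_itv b c cphi) => //.
  exact: subset_itv_oc_cc.
have <- := @Rintegral_itvB R phi (BLeft a) (BRight c) b.
- by rewrite addrC subrK.
- exact: continuous_integrable_itv.
- by rewrite bnd_simp.
- by rewrite bnd_simp.
Qed.

(* At most one of the two intervals is nonempty, unless x = 1. *)
Definition primitive phi (x : R) : R :=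
  \int[leb]_(t in `[1, x]) phi t - \int[leb]_(t in `[x, 1]) phi t.

Lemma Rintegral_itv1 phi (a : R) : \int[leb]_(t in `[a, a]) phi t = 0.
Proof. by rewrite set_itv1 Rintegral_set1. Qed.

Lemma primitive_ge1 phi x : 1 <= x -> primitive phi x = \int[leb]_(t in `[1, x]) phi t.
Proof.
rewrite /primitive le_eqVlt => /predU1P[<-|x1].
  by rewrite Rintegral_itv1 subr0.
by rewrite [X in _ - X](_ : _ = 0) ?subr0// set_itv_ge ?Rintegral_set0// bnd_simp -ltNge.
Qed.

Lemma primitiveE phi a x : continuous phi -> a <= 1 -> a <= x ->
  primitive phi x = \int[leb]_(t in `[a, x]) phi t - \int[leb]_(t in `[a, 1]) phi t.
Proof.
move=> cphi a1 ax; have [x1|x1] := leP 1 x.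
  by rewrite primitive_ge1// (Rintegral_chasles cphi a1 x1) addrAC subrr add0r.
rewrite /primitive (Rintegral_chasles cphi ax (ltW x1)) opprD addrA subrr.
by congr (_ - _); rewrite set_itv_ge ?Rintegral_set0// bnd_simp -ltNge.
Qed.

Lemma is_derive_primitive phi (x : R) : continuous phi ->
  is_derive x (1 : R) (primitive phi) (phi x).
Proof.
(* A base point below both [x] and 1 makes [x] interior to an interval of integration and spares a
   case distinction between [x < 1] and [x >= 1]. *)
move=> cphi; pose a := Num.min x 1 - 1.
have ax : a < x by rewrite /a ltrBlDr; apply: (@le_lt_trans _ _ x); rewrite ?ge_min ?lexx// ltrDl.
have a1 : a <= 1 by rewrite /a lerBlDr (@le_trans _ _ 1)// ?ge_min ?lexx ?orbT// lerDl.
pose I y := \int[leb]_(t in `[a, y]) phi t.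
have [dI I'] : derivable I x 1 /\ I^`()%classic x = phi x.
  apply: (@continuous_FTC1_closed _ phi a x (x + 1)) => //; last exact: cphi.
    by rewrite ltrDl.
  exact: continuous_integrable_itv.
apply: (@near_eq_is_derive _ _ _ (fun y => I y - \int[leb]_(t in `[a, 1]) phi t)).
  by near=> y; rewrite (@primitiveE phi a y)//; apply: ltW; near: y; exact: lt_nbhsr.
have dIx : is_derive x 1 I (phi x) by apply: DeriveDef => //; rewrite -derive1E.
by apply: is_derive_eq; rewrite subr0.
Unshelve. all: by end_near. Qed.

Lemma continuous_primitive phi : continuous phi -> continuous (primitive phi).
Proof.
move=> cphi x; apply/differentiable_continuous/derivable1_diffP.
by have [] := is_derive_primitive x cphi.
Qed.

Lemma primitive_increment phi a b : continuous phi -> (forall x : R, a < x < b -> 0 < phi x) ->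
  a < b -> primitive phi a < primitive phi b.
Proof.
move=> cphi phi0 ab; have [||c] := @MVT _ (primitive phi) phi a b ab.
- by move=> x _; exact: is_derive_primitive.
- by apply: continuous_subspaceT; exact: continuous_primitive.
rewrite in_itv/= => cab /eqP; rewrite subr_eq => /eqP ->.
by rewrite ltrDr mulr_gt0// ?phi0// subr_gt0.
Qed.

(** Stated in the extended reals because the tail may a priori be infinite; the identity then
    carries an infinite tail at 1 over to every [r >= 1]. *)
Lemma integral_tail w (r : R) : continuous w -> (forall s, 0 <= w s) -> 1 <= r ->
  (\int[leb]_(s in `[1%R, +oo[) (w s)%:E =
   (primitive w r)%:E + \int[leb]_(s in `[r, +oo[) (w s)%:E)%E.
Proof.
move=> cw w0 r1.
have mw : measurable_fun setT (EFin \o w).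
  by apply/measurable_EFinP; exact: continuous_measurable_fun.
have -> : `[1%R, +oo[%classic = `[1%R, r]%classic `|` `]r, +oo[%classic.
  by rewrite -itv_bndbnd_setU// bnd_simp.
rewrite ge0_integral_setU//=; last 3 first.
- exact: measurable_funTS mw.
- by move=> x _; rewrite lee_fin.
- apply/disj_setPS => y [/=]; rewrite !in_itv/= => /andP[_ yr].
  by rewrite andbT ltNge yr.
congr (_ + _)%E.
  rewrite primitive_ge1// fineK//; apply: integrable_fin_num => //.
  exact: (continuous_integrable_itv 1 r cw).
by rewrite integral_itv_obnd_cbnd//; exact: measurable_funTS mw.
Qed.

End primitive.

(* With F(t) = int_1^t e^{-C(r)} int_r^oo e^C f / alpha, the function q = F'/F
   satisfies q' = - gamma q - f / (alpha F) - q^2, and F <= c f. *)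
Section riccati.
Context {R : realType}.
Local Notation leb := (@lebesgue_measure R).
Variables (gam f al : R -> R) (c : R).
Hypotheses (cgam : continuous gam) (cf : continuous f) (cal : continuous al).
Hypotheses (f0 : forall x, 0 < f x) (al0 : forall x, 0 < al x) (c0 : 0 < c).

Let C := primitive gam.
Let w s := expR (C s) * (f s / al s).

Hypothesis hfc : forall t, 1 <= t ->
  (\int[leb]_(r in `[1%R, t]) ((expR (- C r))%:E *
     \int[leb]_(s in `[r, +oo[) (w s)%:E) <= (c * f t)%:E)%E.

Let cC : continuous C. Proof. exact: continuous_primitive. Qed.

Let dC (x : R) : is_derive x (1 : R) C (gam x).
Proof. exact: is_derive_primitive. Qed.

Let cw : continuous w.
Proof.
move=> x; apply: cvgM.
  by apply: (@continuous_comp _ _ _ C expR); [exact: cC|exact: continuous_expR].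
by apply: cvgM; [exact: cf|apply: cvgV; [rewrite gt_eqF|exact: cal]].
Qed.

Let w0 s : 0 < w s.
Proof. by rewrite mulr_gt0 ?expR_gt0// divr_gt0. Qed.

Let tail r := (\int[leb]_(s in `[r, +oo[) (w s)%:E)%E.

Let tail_ge0 r : (0 <= tail r)%E.
Proof. by apply: integral_ge0 => s _; rewrite lee_fin ltW. Qed.

(** An infinite tail at 1 would be infinite at every [r >= 1], so the double integral over [[1, 2]]
    would be infinite, against the bound [c * f 2]. *)
Let tail1_fin : tail 1 \is a fin_num.
Proof.
rewrite ge0_fin_numE// ltNge leye_eq; apply/negP => /eqP oo.
have tailoo r : 1 <= r -> tail r = +oo%E.
  move=> r1; have := integral_tail cw (fun s => ltW (w0 s)) r1.
  rewrite -/(tail 1) -/(tail r) oo; case: (tail r) (tail_ge0 r) => //.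
have : (1 <= 2 :> R) by rewrite ler1n.
move=> /hfc; apply/negP; rewrite -ltNge.
rewrite (@eq_integral _ _ _ _ _ (cst +oo%E)); last first.
  move=> r /set_mem /=; rewrite in_itv/= => /andP[r1 _].
  by rewrite -/(tail r) tailoo// gt0_muley// lte_fin expR_gt0.
rewrite integral_cst//= [X in (_ * X)%E](_ : _ = 1%:E) ?mule1 ?ltry//.
rewrite lebesgue_measure_itv/= lte_fin ltr1n/= -EFinB; congr EFin; lra.
Qed.

(** A real-valued version of the tail, differentiable on the whole line; it agrees with [tail] from
    1 on. *)
Let g r := fine (tail 1) - primitive w r.

Let tailE r : 1 <= r -> tail r = (g r)%:E.
Proof.
move=> r1; have := integral_tail cw (fun s => ltW (w0 s)) r1.
rewrite -/(tail 1) -/(tail r) /g => t1.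
have tf : tail r \is a fin_num.
  have := tail1_fin; rewrite t1 fin_numD => /andP[_ ->]//.
rewrite t1 -(fineK tf) -EFinD/=; congr EFin; lra.
Qed.

Let dg (x : R) : is_derive x (1 : R) g (- w x).
Proof.
have dw := is_derive_primitive x cw.
by rewrite /g; apply: is_derive_eq; ring.
Qed.

Let cg : continuous g.
Proof.
move=> x; apply: cvgB; first exact: cvg_cst.
exact: continuous_primitive.
Qed.

Let g_gt0 r : 1 <= r -> 0 < g r.
Proof.
move=> r1; have gr : 0 <= g (r + 1).
  by rewrite -lee_fin -tailE// (le_trans r1)// lerDl.
have : primitive w r < primitive w (r + 1) by apply: primitive_increment => //; rewrite ltrDl.
by move: gr; rewrite /g; lra.
Qed.

Let p r := expR (- C r) * g r.

Let cp : continuous p.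
Proof.
move=> x; apply: cvgM; last exact: cg.
apply: (@continuous_comp _ _ _ (fun r => - C r) expR); last exact: continuous_expR.
by apply: cvgN; exact: cC.
Qed.

Let p_gt0 r : 1 <= r -> 0 < p r.
Proof. by move=> r1; rewrite mulr_gt0 ?expR_gt0 ?g_gt0. Qed.

Let dp (x : R) : is_derive x (1 : R) p (- gam x * p x - f x / al x).
Proof.
have dCx := dC x; have dgx := dg x.
rewrite /p; apply: is_derive_eq.
rewrite /GRing.scale/= /w.
have uv : expR (- C x) * expR (C x) = 1 by rewrite -expRD addNr expR0.
by rewrite -[X in _ - X]mul1r -uv; ring.
Qed.

Let F := primitive p.

Let dF (x : R) : is_derive x (1 : R) F (p x).
Proof. exact: is_derive_primitive. Qed.

Let F_gt0 r : 1 < r -> 0 < F r.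
Proof.
move=> r1; have := @primitive_increment _ p 1 r cp; rewrite -/F.
have -> : F 1 = 0 by rewrite /F primitive_ge1// Rintegral_itv1.
by apply => // x /andP[/ltW x1 _]; exact: p_gt0.
Qed.

Let F_le r : 1 <= r -> F r <= c * f r.
Proof.
move=> r1; rewrite -lee_fin; apply: le_trans (hfc r1).
rewrite /F primitive_ge1// fineK; last first.
  by apply: integrable_fin_num => //; exact: (continuous_integrable_itv 1 r cp).
rewrite le_eqVlt; apply/orP; left; apply/eqP; apply: eq_integral => s /set_mem /=.
by rewrite in_itv/= => /andP[s1 _]; rewrite -/(tail s) tailE.
Qed.

(** The range is [r > 1] because [F] vanishes at 1. The derivative [q'] is an explicit witness so
    that its continuity can be recorded: the field built from [q] has to be of class C^1. *)
Lemma riccati_supersolution : exists q q' : R -> R, forall r, 1 < r ->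
  [/\ 0 <= q r, is_derive r (1 : R) q (q' r), {for r, continuous q'} &
      q' r + gam r * q r + q r ^+ 2 <= - (c * al r)^-1].
Proof.
exists (fun r => p r / F r).
exists (fun r => - gam r * (p r / F r) - f r / al r / F r - (p r / F r) ^+ 2) => r r1.
have Fr := F_gt0 r1; have pr := p_gt0 (ltW r1).
have Fr0 : F r != 0 by rewrite gt_eqF.
have cpF : {for r, continuous (fun r => p r / F r)}.
  apply: cvgM; first exact: cp.
  by apply: cvgV => //; exact: continuous_primitive.
split.
- by rewrite divr_ge0// ltW.
- have dpr := dp r; have dFr := dF r; have dVr := is_deriveV Fr0 dFr.
  apply: (@is_derive_eq _ _ _ (fun r => p r * (F r)^-1)).
  by rewrite /GRing.scale/=; field; rewrite Fr0 gt_eqF.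
- apply: cvgB; last by apply: cvgM.
  apply: cvgB; first by apply: cvgM => //; apply: cvgN; exact: cgam.
  apply: cvgM; last by apply: cvgV => //; exact: continuous_primitive.
  by apply: cvgM; [exact: cf|apply: cvgV; [rewrite gt_eqF|exact: cal]].
(* The only place where [F <= c f] enters; the other terms of the Riccati equation cancel
   exactly. *)
- have : (c * al r)^-1 <= f r / al r / F r.
    rewrite invfM mulrC -!mulrA mulrCA ler_pM2l ?invr_gt0//.
    rewrite ler_pdivlMr// ler_pdivrMl// mulrC.
    by have := F_le (ltW r1); rewrite mulrC.
  lra.
Qed.

End riccati.

(** * Continuity of [gamma] and [alpha], and the Riccati inequality for them *)

Section coefficients.
Context {R : realType} {d : nat}.
Local Notation leb := (@lebesgue_measure R).

Lemma continuous_mul (T : topologicalType) (f g : T -> R) :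
  continuous f -> continuous g -> continuous (fun x => f x * g x).
Proof. by move=> cf cg x; apply: cvgM; [exact: cf|exact: cg]. Qed.

Lemma continuous_add (T : topologicalType) (f g : T -> R) :
  continuous f -> continuous g -> continuous (fun x => f x + g x).
Proof. by move=> cf cg x; apply: cvgD; [exact: cf|exact: cg]. Qed.

Lemma continuous_atM (T : topologicalType) (f g : T -> R) (x : T) :
  {for x, continuous f} -> {for x, continuous g} ->
  {for x, continuous (fun x => f x * g x)}.
Proof. by move=> cf cg; exact: cvgM. Qed.

Lemma continuous_atV (T : topologicalType) (f : T -> R) (x : T) : f x != 0 ->
  {for x, continuous f} -> {for x, continuous (fun x => (f x)^-1)}.
Proof. by move=> fx cf; exact: cvgV. Qed.

Lemma continuous_atN (T : topologicalType) (f : T -> R) (x : T) :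
  {for x, continuous f} -> {for x, continuous (fun x => - f x)}.
Proof. by move=> cf; exact: cvgN. Qed.

Lemma mulrV_coord (A : 'M[R]_d) (u : 'rV[R]_d) (i : 'I_d) :
  mulrV A u ord0 i = \sum_j A i j * u ord0 j.
Proof. by rewrite mxE; apply: eq_bigr => j _; rewrite mxE mulrC. Qed.

Lemma continuous_inner (T : topologicalType) (u v : T -> 'rV[R]_d) :
  (forall i, continuous (fun t => u t ord0 i)) ->
  (forall i, continuous (fun t => v t ord0 i)) ->
  continuous (fun t => inner (u t) (v t)).
Proof. by move=> cu cv; apply: continuous_sum => i; exact: continuous_mul. Qed.

Lemma continuous_mulrV (T : topologicalType) (A : T -> 'M[R]_d) (u : T -> 'rV[R]_d) :
  (forall i j, continuous (fun t => A t i j)) ->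
  (forall i, continuous (fun t => u t ord0 i)) ->
  forall i : 'I_d, continuous (fun t => mulrV (A t) (u t) ord0 i).
Proof.
move=> cA cu i; under eq_fun do rewrite mulrV_coord.
by apply: continuous_sum => j; exact: continuous_mul.
Qed.

Lemma enorm_gt0 (x : 'rV[R]_d) : (0 < enorm x) = (x != 0).
Proof.
rewrite lt_neqAle enorm_ge0 andbT eq_sym; congr negb; apply/eqP/eqP => [x0|->].
  apply/rowP => i; rewrite mxE; apply/eqP; rewrite -normr_le0 -x0.
  exact: coord_le_enorm.
by rewrite /enorm /inner big1 ?sqrtr0// => i _; rewrite mxE mul0r.
Qed.

Implicit Types (x v : 'rV[R]_d).
Variables (a : 'rV[R]_d -> 'M[R]_d) (V : 'rV[R]_d -> R).
Hypothesis hd : (0 < d)%N.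
Hypothesis ca : forall i j, continuous (fun x => a x i j).
Hypothesis cb : forall i, continuous (fun x => drift a V x ord0 i).
Hypothesis apos : forall x v, v != 0 -> 0 < inner (mulrV (a x) v) v.

Let A x := inner (mulrV (a x) x) x.
Let T x := \tr (a x) + inner (drift a V x) x.

Lemma continuous_quadratic : continuous (fun x => inner (mulrV (a x) x) x).
Proof.
apply: continuous_inner; last exact: continuous_coord.
by apply: continuous_mulrV => //; exact: continuous_coord.
Qed.

Lemma continuous_trace_drift :
  continuous (fun x => \tr (a x) + inner (drift a V x) x).
Proof.
apply: continuous_add; first by apply: continuous_sum => i; exact: ca.
by apply: continuous_inner => //; exact: continuous_coord.
Qed.

(** With [enorm x] in place of the radius, [G] and [H] are functions of the point alone, continuous
    off the origin. [gamma] plus [1 / r] is the spherical supremum of [G], and [alpha] is minus that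
    of [H], so one continuity lemma serves both. *)
Let G x := enorm x * T x / A x.
Let H x := - ((enorm x ^+ 2)^-1 * A x).

Let cG x : x != 0 -> {for x, continuous G}.
Proof.
move=> x0; apply: continuous_atM.
  by apply: continuous_atM; [exact: continuous_enorm|exact: continuous_trace_drift].
by apply: continuous_atV; [rewrite gt_eqF// apos|exact: continuous_quadratic].
Qed.

Let cH x : x != 0 -> {for x, continuous H}.
Proof.
move=> x0; apply/continuous_atN/continuous_atM; last exact: continuous_quadratic.
apply: continuous_atV; first by rewrite gt_eqF// exprn_gt0// enorm_gt0.
exact: continuous_sqr continuous_enorm x.
Qed.

Let gammaE r : gamma a V r = sup [set G x | x in sphere r] - r^-1.
Proof.
rewrite /gamma; congr (sup _ - _); apply/seteqP.
by split => _ [x xr <-]; exists x => //; rewrite /G /T /A xr.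
Qed.

Let alphaE r : alpha a r = - sup [set H x | x in sphere r].
Proof.
rewrite /alpha /inf; congr (- sup _); apply/seteqP; split.
  by move=> _ [_ [x xr <-] <-]; exists x => //; rewrite /H /A xr.
by move=> _ [x xr <-]; eexists; [exists x => //|rewrite /H /A xr].
Qed.

Lemma gamma_ge x : x != 0 ->
  enorm x * (\tr (a x) + inner (drift a V x) x) / inner (mulrV (a x) x) x
    - (enorm x)^-1 <= gamma a V (enorm x).
Proof.
move=> x0; rewrite gammaE lerD2r; apply: ub_le_sup; last by exists x.
by apply: (sphere_ubound hd cG); rewrite enorm_gt0.
Qed.

Lemma alpha_le x : x != 0 ->
  alpha a (enorm x) <= (enorm x ^+ 2)^-1 * inner (mulrV (a x) x) x.
Proof.
move=> x0; rewrite alphaE lerNl; apply: ub_le_sup; last by exists x.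
by apply: (sphere_ubound hd cH); rewrite enorm_gt0.
Qed.

Lemma alpha_gt0 (r : R) : 0 < r -> 0 < alpha a r.
Proof.
move=> r0; rewrite alphaE.
have [x xr ->] := sphere_sup_attained hd cH r0.
have x0 : x != 0 by rewrite -enorm_gt0 xr.
by rewrite opprK mulr_gt0 ?apos// invr_gt0 exprn_gt0// enorm_gt0.
Qed.

Lemma continuous_gamma (r : R) : 0 < r -> {for r, continuous (gamma a V)}.
Proof.
move=> r0; rewrite (_ : gamma a V = fun r => sup [set G x | x in sphere r] - r^-1).
  by apply: cvgB; [exact: (continuous_sphere_sup hd cG r0)|apply: cvgV; [rewrite gt_eqF|exact: cvg_id]].
by apply/funext => s; exact: gammaE.
Qed.

Lemma continuous_alpha (r : R) : 0 < r -> {for r, continuous (alpha a)}.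
Proof.
move=> r0; rewrite (_ : alpha a = fun r => - sup [set H x | x in sphere r]).
  by apply: cvgN; exact: (continuous_sphere_sup hd cH r0).
by apply/funext => s; exact: alphaE.
Qed.

(** Freezing a function at its value in 1 makes it continuous on the whole line, as the Riccati
    section assumes, and leaves all integrals over subsets of [[1, +oo[] unchanged. *)
Let trunc (g : R -> R) r := g (Num.max 1 r).

Let continuous_trunc (g : R -> R) : (forall r : R, 0 < r -> {for r, continuous g}) ->
  continuous (trunc g).
Proof.
move=> cg x; apply: (@continuous_comp _ _ _ (fun r : R => Num.max 1 r) g).
  by apply: continuous_max; [exact: cvg_cst|exact: cvg_id].
by apply: cg; rewrite lt_max ltr01.
Qed.

Let truncE (g : R -> R) r : 1 <= r -> trunc g r = g r.
Proof. by move=> r1; rewrite /trunc max_r. Qed.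

Lemma Cint_primitive r : 1 <= r -> Cint a V r = primitive (trunc (gamma a V)) r.
Proof.
move=> r1; rewrite /Cint r1 primitive_ge1//; apply: eq_Rintegral => s.
by rewrite inE/= in_itv/= => /andP[s1 _]; rewrite truncE.
Qed.

Lemma within_continuous_trunc (f : R -> R) : {within `[1, +oo[, continuous f} ->
  continuous (trunc f).
Proof.
move=> /continuous_within_itvcyP[cf f1] x.
case: (ltgtP (x : R) 1) => [x1|x1|->].
- apply: (@near_cst_continuous _ _ (f 1)).
  by near=> y; rewrite /trunc max_l// ltW//; near: y; exact: lt_nbhsl.
- rewrite /continuous_at /trunc max_r ?ltW//.
  apply: cvg_trans (cf x _); last by rewrite in_itv/= x1.
  apply: near_eq_cvg; near=> y; rewrite max_r// ltW//; near: y; exact: lt_nbhsr.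
- have f1' : f @ 1^'+ --> f 1 := f1.
  apply/cvgrPdist_lt => e e0; move/cvgrPdist_lt : f1' => /(_ e e0).
  rewrite near_withinE => h; rewrite /trunc maxxx; apply: filterS h => y h.
  have [y1|y1] := leP y 1; first by rewrite subrr normr0.
  exact: h.
Unshelve. all: by end_near. Qed.

Lemma riccati_gamma_alpha (f : R -> R) : {within `[1, +oo[, continuous f} ->
  (forall t, 1 <= t -> 0 < f t) ->
  (ereal_sup
    [set ((f t)^-1)%:E *
         \int[leb]_(r in `[1%R, t])
           ((expR (- Cint a V r))%:E *
            \int[leb]_(s in `[r, +oo[)
              (expR (Cint a V s) * (f s / alpha a s))%:E)
    | t in [set t : R | (1 <= t)%R]] < +oo)%E ->
  exists (c : R) (q q' : R -> R), 0 < c /\ forall r, 1 < r ->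
  [/\ 0 <= q r, is_derive r (1 : R) q (q' r), {for r, continuous q'} &
      q' r + gamma a V r * q r + q r ^+ 2 <= - (c * alpha a r)^-1].
Proof.
move=> cf f0; set S := ereal_sup _ => Soo.
pose I t := (\int[leb]_(r in `[1%R, t])
           ((expR (- Cint a V r))%:E *
            \int[leb]_(s in `[r, +oo[)
              (expR (Cint a V s) * (f s / alpha a s))%:E))%E.
have IS t : 1 <= t -> (((f t)^-1)%:E * I t <= S)%E.
  by move=> t1; apply: ereal_sup_ubound; exists t.
have I0 t : (0 <= I t)%E.
  apply: integral_ge0 => r; rewrite /= in_itv/= => /andP[r1 _].
  apply: mule_ge0; first by rewrite lee_fin expR_ge0.
  apply: integral_ge0 => s; rewrite /= in_itv/= andbT => rs.
  have s1 : 1 <= s := le_trans r1 rs.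
  by rewrite lee_fin mulr_ge0 ?expR_ge0// divr_ge0// ltW ?f0// alpha_gt0// (lt_le_trans ltr01).
have S0 : (0 <= S)%E.
  by apply: le_trans (IS 1 _) => //; rewrite mule_ge0// lee_fin invr_ge0 ltW// f0.
have Sfin : S \is a fin_num by rewrite ge0_fin_numE.
(* The supremum is only known to be nonnegative; adding 1 makes the constant positive. *)
pose c := fine S + 1.
have c0 : 0 < c by rewrite ltr_wpDl// fine_ge0.
have [q [q' hq]] : exists q q' : R -> R, forall r, 1 < r ->
  [/\ 0 <= q r, is_derive r (1 : R) q (q' r), {for r, continuous q'} &
      q' r + trunc (gamma a V) r * q r + q r ^+ 2 <= - (c * trunc (alpha a) r)^-1].
  apply: (@riccati_supersolution _ _ (trunc f)) => //.
  - exact/continuous_trunc/continuous_gamma.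
  - exact: within_continuous_trunc.
  - exact/continuous_trunc/continuous_alpha.
  - by move=> x; apply: f0; rewrite le_max lexx.
  - by move=> x; apply: alpha_gt0; rewrite lt_max ltr01.
  move=> t t1; apply: (@le_trans _ _ (I t)).
    rewrite le_eqVlt; apply/orP; left; apply/eqP; apply: eq_integral.
    move=> r /set_mem/=; rewrite in_itv/= => /andP[r1 _].
    rewrite Cint_primitive//; congr (_ * _)%E; apply: eq_integral => s /set_mem/=.
    rewrite in_itv/= andbT => rs; have s1 : 1 <= s := le_trans r1 rs.
    by rewrite Cint_primitive// !truncE.
  rewrite truncE//.
  have ft := f0 t t1.
  have -> : I t = ((f t)%:E * (((f t)^-1)%:E * I t))%E.
    by rewrite muleA -EFinM divff ?mul1e// gt_eqF.
  rewrite mulrC EFinM; apply: lee_pmul => //.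
  - by rewrite lee_fin ltW.
  - by rewrite mule_ge0// lee_fin invr_ge0 ltW.
  apply: (le_trans (IS t t1)); rewrite -(fineK Sfin) lee_fin /c; lra.
exists c, q, q'; split => // r r1.
by have := hq r r1; rewrite !truncE// ltW.
Qed.

End coefficients.

(** * The divergence of a weighted radial field *)

Section directional_calculus.
Context {R : realType} (U : normedModType R).
Implicit Types (f g : U -> R) (x v : U).

Lemma is_derive_mul f g x v df dg : is_derive x v f df -> is_derive x v g dg ->
  is_derive x v (fun y => f y * g y) (f x * dg + g x * df).
Proof. by move=> hf hg; apply: is_derive_eq. Qed.

Lemma is_derive_bigsum (I : Type) (r : seq I) (F : I -> U -> R) (dF : I -> R) x v :
  (forall i, is_derive x v (F i) (dF i)) ->
  is_derive x v (fun y => \sum_(i <- r) F i y) (\sum_(i <- r) dF i).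
Proof.
move=> hF; elim: r => [|i r ih].
  rewrite big_nil (_ : (fun _ => _) = cst 0); first exact: is_derive_cst.
  by apply/funext => y; rewrite big_nil.
rewrite big_cons (_ : (fun _ => _) = F i \+ (fun y => \sum_(i <- r) F i y)).
  exact: is_deriveD.
by apply/funext => y; rewrite big_cons.
Qed.

Lemma is_derive_line f x v df :
  is_derive x v f df <-> is_derive (0 : R) (1 : R) (fun t : R => f (t *: v + x)) df.
Proof.
have [E D] : 'D_v f x = 'D_(1 : R) (fun t : R => f (t *: v + x)) (0 : R) /\
    (derivable f x v <-> derivable (fun t : R => f (t *: v + x)) (0 : R) (1 : R)).
  by apply: derive_along => t; rewrite addr0 /GRing.scale/= mulr1.
by split => -[d <-]; (apply: DeriveDef; [exact/D|rewrite E]).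
Qed.

(** Since [f] is only assumed to have a derivative along [v], the composition is differentiated on
    the line through [x], by the chain rule in one variable. *)
Lemma is_derive_chain (phi : R -> R) f x v dphi df :
  is_derive (f x) (1 : R) phi dphi -> is_derive x v f df ->
  is_derive x v (fun y => phi (f y)) (dphi * df).
Proof.
move=> hphi /is_derive_line hf; apply/is_derive_line.
set g := fun t : R => f (t *: v + x) in hf *.
have g0 : f x = g 0 by rewrite /g scale0r add0r.
rewrite g0 in hphi; have [dg gE] := hf; have [dp pE] := hphi.
apply: DeriveDef.
  apply/derivable1_diffP; apply: (@differentiable_comp _ _ _ _ g phi).
    exact/derivable1_diffP.
  exact/derivable1_diffP.
by rewrite -derive1E (@derive1_comp _ g phi)// !derive1E gE pE.
Qed.

End directional_calculus.

Section divergence.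
Context {R : realType} {d : nat}.
Local Notation lebn := (@lebesgue_rV R d).
Local Notation e i := (delta_mx ord0 i : 'rV[R]_d).

Lemma is_derive_coord (x v : 'rV[R]_d) (j : 'I_d) :
  is_derive x v (fun y : 'rV[R]_d => y ord0 j) (v ord0 j).
Proof.
apply/is_derive_line; under eq_fun do rewrite !mxE.
by apply: is_derive_eq; rewrite /GRing.scale/= ?(mulr0, mulr1, addr0, add0r).
Qed.

Lemma is_derive_inner_self (x : 'rV[R]_d) (i : 'I_d) :
  is_derive x (e i) (fun y => inner y y) (2 * x ord0 i).
Proof.
have <- : \sum_j (x ord0 j * e i ord0 j + x ord0 j * e i ord0 j) = 2 * x ord0 i.
  rewrite (bigD1 i)//= big1 => [|j ji].
    by rewrite !mxE !eqxx/=; ring.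
  by rewrite !mxE (negbTE ji) andbF mulr0 addr0.
rewrite /inner; apply: is_derive_bigsum => j.
by apply: is_derive_mul; exact: is_derive_coord.
Qed.

Lemma is_derive_partial (f : 'rV[R]_d -> R) (x : 'rV[R]_d) i :
  derivable f x (e i) -> is_derive x (e i) f (partial f i x).
Proof. by move=> df; apply: DeriveDef. Qed.

Lemma innerC (u v : 'rV[R]_d) : inner u v = inner v u.
Proof. by apply: eq_bigr => i _; rewrite mulrC. Qed.

Lemma innerDl (u v w : 'rV[R]_d) : inner (u + v) w = inner u w + inner v w.
Proof. by rewrite /inner -big_split; apply: eq_bigr => i _; rewrite mxE mulrDl. Qed.

Lemma innerDr (u v w : 'rV[R]_d) : inner u (v + w) = inner u v + inner u w.
Proof. by rewrite innerC innerDl !(innerC _ u). Qed.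

Lemma mulrVD (A : 'M[R]_d) (u v : 'rV[R]_d) : mulrV A (u + v) = mulrV A u + mulrV A v.
Proof. exact: mulmxDl. Qed.

Lemma mulrVZ (A : 'M[R]_d) c (u : 'rV[R]_d) : mulrV A (c *: u) = c *: mulrV A u.
Proof. by rewrite /mulrV -scalemxAl. Qed.

Lemma inner_mulrVC (A : 'M[R]_d) (u v : 'rV[R]_d) : A^T = A ->
  inner (mulrV A u) v = inner (mulrV A v) u.
Proof.
move=> AT; rewrite /inner; under eq_bigr do rewrite mulrV_coord mulr_suml.
under [RHS]eq_bigr do rewrite mulrV_coord mulr_suml.
rewrite exchange_big/=; apply: eq_bigr => i _; apply: eq_bigr => j _.
by rewrite -[in LHS]AT mxE; ring.
Qed.

Variables (a : 'rV[R]_d -> 'M[R]_d) (V h : 'rV[R]_d -> R) (k k' : R -> R) (N : R).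
Hypothesis asym : forall x, (a x)^T = a x.
Hypothesis ha : forall i j, Ck 2 (fun x => a x i j).
Hypothesis hV : Ck 2 V.
Hypothesis hh : Ck 1 h.
Hypothesis dk : forall t : R, is_derive t (1 : R) k (k' t).
Hypothesis ck' : continuous k'.
Hypothesis N0 : 0 <= N.
Hypothesis k0 : forall t, N ^+ 2 < t -> k t = 0.

Let w x := mulrV (a x) x.
(** Component [i] of the vector field. Dependence on [inner x x] instead of the norm keeps the field
    of class C^1 through the origin. *)
Let u i x := h x * h x * (expR (V x) * (k (inner x x) * w x ord0 i)).

Let dw i x := \sum_j (a x i j * e i ord0 j + x ord0 j * partial (fun y => a y i j) i x).

Let du i x := h x * h x * (expR (V x) * (k (inner x x) * dw i x +
    w x ord0 i * (k' (inner x x) * (2 * x ord0 i))) +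
  k (inner x x) * w x ord0 i * (expR (V x) * partial V i x)) +
  expR (V x) * (k (inner x x) * w x ord0 i) * (h x * partial h i x + h x * partial h i x).

Let is_derive_u i x : is_derive x (e i) (u i) (du i x).
Proof.
apply: is_derive_mul.
  by apply: is_derive_mul; apply: is_derive_partial; have [_ /(_ i)[]] := hh.
apply: is_derive_mul.
  have dV : is_derive x (e i) V (partial V i x).
    by apply: is_derive_partial; have [_ /(_ i)[]] := hV.
  exact: (is_derive_chain (is_derive_expR (V x)) dV).
apply: is_derive_mul.
  exact: (@is_derive_chain R _ k (fun y : 'rV[R]_d => inner y y) x (e i) _ _
    (dk (inner x x)) (is_derive_inner_self x i)).
rewrite /w; under eq_fun do rewrite mulrV_coord.
apply: is_derive_bigsum => j; apply: is_derive_mul.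
  by apply: is_derive_partial; have [_ /(_ i)[]] := ha i j.
exact: is_derive_coord.
Qed.

Let ca i j : continuous (fun x => a x i j). Proof. by have [] := ha i j. Qed.
Let ch : continuous h. Proof. by have [] := hh. Qed.
Let cph i : continuous (partial h i). Proof. by have [_ /(_ i)[]] := hh. Qed.
Let cV : continuous V. Proof. by have [] := hV. Qed.
Let cpV i : continuous (partial V i). Proof. by have [_ /(_ i)[_ []]] := hV. Qed.
Let cpa i j l : continuous (partial (fun x => a x i j) l).
Proof. by have [_ /(_ l)[_ []]] := ha i j. Qed.

Let cexpV : continuous (fun x => expR (V x)).
Proof.
by move=> x; apply: (@continuous_comp _ _ _ V expR); [exact: cV|exact: continuous_expR].
Qed.

Let ck : continuous (fun x : 'rV[R]_d => k (inner x x)).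
Proof.
move=> x; apply: (@continuous_comp _ _ _ (fun x : 'rV[R]_d => inner x x) k).
  exact: continuous_inner_self.
by apply/differentiable_continuous/derivable1_diffP; have [] := dk (inner x x).
Qed.

Let ckk' : continuous (fun x : 'rV[R]_d => k' (inner x x)).
Proof.
move=> x; apply: (@continuous_comp _ _ _ (fun x : 'rV[R]_d => inner x x) k').
  exact: continuous_inner_self.
exact: ck'.
Qed.

Let cw i : continuous (fun x => w x ord0 i).
Proof. by apply: continuous_mulrV => //; exact: continuous_coord. Qed.

Let cc i : continuous (fun x : 'rV[R]_d => x ord0 i). Proof. exact: continuous_coord. Qed.

Let cdw i : continuous (dw i).
Proof.
apply: continuous_sum => j; apply: continuous_add; apply: continuous_mul => //.
exact: cst_continuous.
Qed.

Let c2 : continuous (fun _ : 'rV[R]_d => 2 : R). Proof. exact: cst_continuous. Qed.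

Let cdu i : continuous (du i).
Proof.
have c1 := continuous_mul ch ch.
have c3 := continuous_mul ckk' (continuous_mul c2 (@cc i)).
have c4 := continuous_add (continuous_mul ck (@cdw i)) (continuous_mul (@cw i) c3).
have c5 := continuous_mul (continuous_mul ck (@cw i)) (continuous_mul cexpV (@cpV i)).
have c6 := continuous_add (continuous_mul ch (@cph i)) (continuous_mul ch (@cph i)).
have c7 := continuous_mul (continuous_mul cexpV (continuous_mul ck (@cw i))) c6.
have c8 := continuous_mul c1 (continuous_add (continuous_mul cexpV c4) c5).
exact: (continuous_add c8 c7).
Qed.

(** The divergence of the field, grouped by the factor that is differentiated. The first group rests
    on [div (e^V a x) = e^V (tr a + <b, x>)], which is what the choice of the drift [b] provides. *)
Definition weighted_div x : R := expR (V x) *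
  (h x ^+ 2 * k (inner x x) * (\tr (a x) + inner (drift a V x) x) +
   2 * (h x * k (inner x x) * inner (mulrV (a x) x) (grad h x)) +
   2 * (h x ^+ 2 * k' (inner x x) * inner (mulrV (a x) x) x)).

Let sum_du x : \sum_i du i x = weighted_div x.
Proof.
rewrite /weighted_div.
have -> : \tr (a x) + inner (drift a V x) x =
    \sum_i dw i x + \sum_i w x ord0 i * partial V i x.
  have -> : \sum_i dw i x = \tr (a x) + \sum_i \sum_j x ord0 j * partial (fun y => a y i j) i x.
    rewrite -big_split/=; apply: eq_bigr => i _; rewrite /dw big_split/=; congr (_ + _).
    rewrite (bigD1 i)//= big1 => [|j ji]; first by rewrite mxE !eqxx mulr1 addr0.
    by rewrite mxE (negbTE ji) andbF mulr0.
  rewrite -addrA; congr (_ + _); rewrite /inner.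
  under eq_bigr do rewrite mxE mulr_suml.
  rewrite exchange_big/= -big_split/=; apply: eq_bigr => i _.
  rewrite mulrV_coord mulr_suml -big_split/=; apply: eq_bigr => j _.
  (* The divergence differentiates [a i j] in direction [i], the drift in direction [j]; symmetry of
     [a] reconciles the two sums. *)
  have -> : (fun y => a y i j) = (fun y => a y j i).
    by apply/funext => y; rewrite -[in LHS]asym mxE.
  rewrite -[in RHS]asym mxE; ring.
rewrite /inner !(mulr_sumr, mulr_suml, mulrDr) -!big_split/=.
apply: eq_bigr => i _; rewrite /du /grad !mxE -/(w x) -/(w x ord0 i); ring.
Qed.

Let u0 i x : ~ cube N d x -> u i x = 0.
Proof.
move=> xN; rewrite /u k0 ?(mul0r, mulr0)//.
rewrite ltNge; apply/negP => xx; apply: xN => j.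
rewrite -(@ler_pXn2r _ 2)// ?nnegrE// (le_trans _ xx)// real_normK ?num_real//.
rewrite /inner (bigD1 j)//= -expr2 lerDl sumr_ge0// => l _.
by rewrite -expr2 sqr_ge0.
Qed.

Let partialu i : partial (u i) i = du i.
Proof. by apply/funext => x; have [] := is_derive_u i x. Qed.

Lemma continuous_weighted_div : continuous weighted_div.
Proof.
rewrite (_ : weighted_div = fun x => \sum_i du i x); first exact: continuous_sum.
by apply/funext => x; rewrite sum_du.
Qed.

Lemma weighted_div_out_cube x : ~ cube N d x -> weighted_div x = 0.
Proof.
move=> xN; rewrite -sum_du big1// => i _; rewrite -partialu.
exact: (partial_out_cube i (u0 i)).
Qed.

Lemma integral_weighted_div : (\int[lebn]_x (weighted_div x)%:E = 0)%E.
Proof.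
under eq_integral do rewrite -sum_du -sumEFin.
rewrite integral_sum//; last first.
  move=> i; rewrite -partialu; apply: (@continuous_integrable _ N).
    by rewrite partialu.
  exact: (partial_out_cube i (u0 i)).
rewrite big1// => i _; rewrite -partialu.
apply: (@integral_partial _ _ _ _ N); last exact: u0.
- by move=> x; have [] := is_derive_u i x.
- by rewrite partialu.
Qed.

End divergence.

(** * Cut-off functions of the variable [t = |x|^2] *)

Section cutoffs.
Context {R : realType}.
Implicit Types t : R.

(** The squared positive part is of class C^1 with a simple derivative, which suffices: the cut-offs
    are differentiated only once. *)
Definition posq t : R := Num.max 0 t ^+ 2.
Definition dposq t : R := 2 * Num.max 0 t.

Lemma continuous_max0 : continuous (fun t : R => Num.max 0 t).
Proof. by move=> t; apply: continuous_max; [exact: cvg_cst|exact: cvg_id]. Qed.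

Lemma is_derive_posq t : is_derive t (1 : R) posq (dposq t).
Proof.
have [t0|t0|->] := ltgtP t 0.
- apply: (@near_eq_is_derive _ _ _ (cst 0)).
    near=> s; rewrite /posq max_l ?expr0n//; apply: ltW.
    by near: s; exact: lt_nbhsl.
  by rewrite /dposq max_l ?ltW// mulr0; exact: is_derive_cst.
- apply: (@near_eq_is_derive _ _ _ (fun s : R => s * s)).
    near=> s; rewrite /posq max_r ?expr2//; apply: ltW.
    by near: s; exact: lt_nbhsr.
  rewrite /dposq max_r ?ltW//; apply: is_derive_eq.
  by rewrite /GRing.scale/=; ring.
(* At 0 the difference quotient of [posq] is [Num.max 0] itself, since
   [posq z = z * Num.max 0 z]. *)
- apply/is_derive1_caratheodory; exists (fun s => Num.max 0 s); split.
  + move=> z; rewrite /posq maxxx expr0n/= !subr0 expr2.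
    by have [z0|z0] := leP z 0; rewrite ?mul0r.
  + exact: continuous_max0.
  + by rewrite /dposq maxxx mulr0.
Unshelve. all: by end_near. Qed.

Lemma continuous_posq : continuous posq.
Proof. exact: continuous_sqr continuous_max0. Qed.

Lemma continuous_dposq : continuous dposq.
Proof.
by apply: continuous_mul; [exact: cst_continuous|exact: continuous_max0].
Qed.

Lemma posq_ge0 t : 0 <= posq t. Proof. exact: sqr_ge0. Qed.
Lemma dposq_ge0 t : 0 <= dposq t. Proof. by rewrite mulr_ge0// le_max lexx. Qed.

Lemma posq_le1 t : t <= 1 -> posq t <= 1.
Proof.
by move=> t1; rewrite /posq expr_le1// ?le_max ?lexx// ge_max ler01.
Qed.

Lemma posq_ge1 t : 1 <= t -> 1 <= posq t.
Proof.
by move=> t1; rewrite /posq exprn_ege1// le_max t1 orbT.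
Qed.

Lemma posq_le0 t : t <= 0 -> posq t = 0.
Proof. by move=> t0; rewrite /posq max_l// expr0n. Qed.

Lemma dposq_le0 t : t <= 0 -> dposq t = 0.
Proof. by move=> t0; rewrite /dposq max_l// mulr0. Qed.

Lemma posq_mono : {homo posq : s t / s <= t}.
Proof.
move=> s t st; have m0 u : 0 <= Num.max 0 u :> R by rewrite le_max lexx.
have mm : Num.max 0 s <= Num.max 0 t by rewrite ge_max m0/= le_max st orbT.
by rewrite /posq ler_pXn2r ?nnegrE.
Qed.

(** A step from 0 on [t <= 2] to 1 on [t >= 3]. The value 2 stays away from the singularity of [q]
    at radius 1; the value 3 is below 4, so the whole transition takes place inside the cube of
    half-side 2. *)
Definition psi t := posq (1 - posq (3 - t)).
Definition dpsi t := dposq (1 - posq (3 - t)) * dposq (3 - t).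
(** Without a plateau: for [t >= 0] it decreases in [t], vanishes from [n.+1] on, and increases to 1
    with [n], which is the form needed for monotone convergence. *)
Definition chi (n : nat) t := posq (1 - t / n.+1%:R).
Definition dchi (n : nat) t := - (dposq (1 - t / n.+1%:R) / n.+1%:R).

Lemma is_derive_psi t : is_derive t (1 : R) psi (dpsi t).
Proof.
have d3 : is_derive t (1 : R) (fun s : R => 3 - s) (-1).
  have := is_deriveB (is_derive_cst (3 : R) t 1) (is_derive_id t (1 : R)).
  by rewrite sub0r.
have dp : is_derive t (1 : R) (fun s : R => 1 - posq (3 - s)) (- (dposq (3 - t) * -1)).
  have := @is_derive_chain R _ posq (fun s : R => 3 - s) t 1 _ _ (is_derive_posq (3 - t)) d3.
  by move=> dq; have := is_deriveB (is_derive_cst (1 : R) t 1) dq; rewrite sub0r.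
have := @is_derive_chain R _ posq (fun s : R => 1 - posq (3 - s)) t 1 _ _
  (is_derive_posq (1 - posq (3 - t))) dp.
by rewrite mulrN1 opprK.
Qed.

Lemma is_derive_chi n t : is_derive t (1 : R) (chi n) (dchi n t).
Proof.
have d1 : is_derive t (1 : R) (fun s : R => 1 - s / n.+1%:R) (- n.+1%:R^-1).
  have dl : is_derive t (1 : R) (fun s : R => s / n.+1%:R) (n.+1%:R^-1).
    have := @is_derive_mul R _ (fun s : R => s) (fun _ : R => n.+1%:R^-1) t 1 1 0
      (is_derive_id _ _) (is_derive_cst _ _ _).
    by rewrite mulr0 add0r mulr1.
  by have := is_deriveB (is_derive_cst (1 : R) t 1) dl; rewrite sub0r.
have := @is_derive_chain R _ posq (fun s : R => 1 - s / n.+1%:R) t 1 _ _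
  (is_derive_posq (1 - t / n.+1%:R)) d1.
by rewrite mulrN.
Qed.

Lemma continuous_dpsi : continuous dpsi.
Proof.
have c3 : continuous (fun t : R => 3 - t).
  by move=> t; apply: cvgB; [exact: cvg_cst|exact: cvg_id].
have cp : continuous (fun t : R => posq (3 - t)).
  by move=> t; apply: (@continuous_comp _ _ _ (fun t : R => 3 - t) posq);
    [exact: c3|exact: continuous_posq].
apply: continuous_mul => t.
  apply: (@continuous_comp _ _ _ (fun t : R => 1 - posq (3 - t)) dposq).
    by apply: cvgB; [exact: cvg_cst|exact: cp].
  exact: continuous_dposq.
by apply: (@continuous_comp _ _ _ (fun t : R => 3 - t) dposq);
  [exact: c3|exact: continuous_dposq].
Qed.

Lemma continuous_dchi n : continuous (dchi n).
Proof.
move=> t; apply: cvgN; apply: cvgM; last exact: cvg_cst.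
apply: (@continuous_comp _ _ _ (fun t : R => 1 - t / n.+1%:R) dposq).
  by apply: cvgB; [exact: cvg_cst|apply: cvgM; [exact: cvg_id|exact: cvg_cst]].
exact: continuous_dposq.
Qed.

Lemma psi_ge0 t : 0 <= psi t. Proof. exact: posq_ge0. Qed.
Lemma psi_le1 t : psi t <= 1.
Proof. by apply: posq_le1; rewrite lerBlDr lerDl posq_ge0. Qed.
Lemma dpsi_ge0 t : 0 <= dpsi t.
Proof. by rewrite mulr_ge0 ?dposq_ge0. Qed.

Lemma psi_le2 t : t <= 2 -> psi t = 0.
Proof.
move=> t2; apply: posq_le0; rewrite subr_le0; apply: posq_ge1; lra.
Qed.

Lemma dpsi_le2 t : t <= 2 -> dpsi t = 0.
Proof.
move=> t2; rewrite /dpsi dposq_le0 ?mul0r// subr_le0; apply: posq_ge1; lra.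
Qed.

Lemma psi_ge3 t : 3 <= t -> psi t = 1.
Proof.
move=> t3; rewrite /psi (posq_le0 (t := 3 - t)); last lra.
by rewrite subr0 /posq max_r// expr1n.
Qed.

Lemma dpsi_ge3 t : 3 <= t -> dpsi t = 0.
Proof. by move=> t3; rewrite /dpsi (dposq_le0 (t := 3 - t)) ?mulr0//; lra. Qed.

Lemma chi_ge0 n t : 0 <= chi n t. Proof. exact: posq_ge0. Qed.
Lemma chi_le1 n t : 0 <= t -> chi n t <= 1.
Proof. by move=> t0; apply: posq_le1; rewrite lerBlDr lerDl divr_ge0. Qed.
Lemma dchi_le0 n t : dchi n t <= 0.
Proof. by rewrite oppr_le0 divr_ge0// dposq_ge0. Qed.

Lemma chi_out n t : n.+1%:R <= t -> chi n t = 0.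
Proof. by move=> nt; apply: posq_le0; rewrite subr_le0 ler_pdivlMr// mul1r. Qed.

Lemma chi_mono t : 0 <= t -> {homo (fun n => chi n t) : m n / (m <= n)%N >-> m <= n}.
Proof.
move=> t0 m n mn; apply: posq_mono; rewrite lerB// ler_wpM2l//.
by rewrite lef_pV2 ?posrE// ler_nat.
Qed.

Lemma cvg_chi t : chi n t @[n --> \oo] --> (1 : R).
Proof.
have -> : (1 : R) = posq (1 - t * 0) by rewrite mulr0 subr0 /posq max_r// expr1n.
apply: (@cvg_comp _ _ _ (fun n : nat => 1 - t / n.+1%:R) posq); last exact: continuous_posq.
apply: cvgB; first exact: cvg_cst.
apply: cvgM; [exact: cvg_cst|exact: cvg_harmonic].
Qed.

End cutoffs.

(* In the last hypothesis, E is <a grad h, grad h> and S is <a x, grad h>. *)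
Lemma riccati_algebra (R : realFieldType) (r A T gam q q' S E h c al eta deta dps : R) :
  0 < r -> 0 < A -> 0 <= q -> 0 < c -> 0 < al -> 0 <= eta -> deta <= dps ->
  r * T / A - r^-1 <= gam -> al <= (r ^+ 2)^-1 * A ->
  q' + gam * q + q ^+ 2 <= - (c * al)^-1 ->
  0 <= E - 2 * (h * (q / r) * S) + (h * (q / r)) ^+ 2 * A ->
  h ^+ 2 * (eta * (q / r)) * T + 2 * (h * (eta * (q / r)) * S) +
  2 * (h ^+ 2 * (deta * (q / r) + eta * (q' / (2 * r ^+ 2) - q / (2 * r ^+ 2 * r))) * A)
  <= eta * E - eta * h ^+ 2 / c + 2 * dps * (q / r) * A * h ^+ 2.
Proof.
move=> r0 A0 q0 c0 al0 eta0 detale hT hal hq hE.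
(* The bound on [gam] solved for [T]; it may then be multiplied by the nonnegative factor
   [q / r]. *)
have Tle : T <= A * (gam + r^-1) / r.
  rewrite ler_pdivlMr// mulrC -ler_pdivrMl// mulrC.
  lra.
have h2 := sqr_ge0 h.
have p1 : 0 <= eta * (E - 2 * (h * (q / r) * S) + (h * (q / r)) ^+ 2 * A) by exact: mulr_ge0.
have qr0 : 0 <= q / r by rewrite divr_ge0// ltW.
have r20 : 0 <= (r ^+ 2)^-1 by rewrite invr_ge0 exprn_ge0// ltW.
have ca0 : 0 <= (c * al)^-1 by rewrite invr_ge0 mulr_ge0// ltW.
have he0 : 0 <= h ^+ 2 * eta by exact: mulr_ge0.
have A0' := ltW A0.
have p2 : 0 <= h ^+ 2 * eta * (q / r) * (A * (gam + r^-1) / r - T).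
  by apply: mulr_ge0; [exact: mulr_ge0|rewrite subr_ge0].
have p3 : 0 <= 2 * h ^+ 2 * (q / r) * A * (dps - deta).
  apply: mulr_ge0; last by rewrite subr_ge0.
  by do 3 apply: mulr_ge0 => //.
have p4 : 0 <= h ^+ 2 * eta * A / r ^+ 2 * (- (c * al)^-1 - (q' + gam * q + q ^+ 2)).
  by apply: mulr_ge0; [do 2 apply: mulr_ge0 => //|rewrite subr_ge0].
have p5 : 0 <= h ^+ 2 * eta / (c * al) * ((r ^+ 2)^-1 * A - al).
  by apply: mulr_ge0; [exact: mulr_ge0|rewrite subr_ge0].
rewrite -subr_ge0.
(* Right side minus left side is exactly a sum of five nonnegative terms: the completed square, the
   bound by [gam], the slope of the cut-off, the Riccati inequality and the bound by [al]. *)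
have -> : eta * E - eta * h ^+ 2 / c + 2 * dps * (q / r) * A * h ^+ 2 -
  (h ^+ 2 * (eta * (q / r)) * T + 2 * (h * (eta * (q / r)) * S) +
  2 * (h ^+ 2 * (deta * (q / r) + eta * (q' / (2 * r ^+ 2) - q / (2 * r ^+ 2 * r))) * A)) =
  eta * (E - 2 * (h * (q / r) * S) + (h * (q / r)) ^+ 2 * A) +
  h ^+ 2 * eta * (q / r) * (A * (gam + r^-1) / r - T) +
  2 * h ^+ 2 * (q / r) * A * (dps - deta) +
  h ^+ 2 * eta * A / r ^+ 2 * (- (c * al)^-1 - (q' + gam * q + q ^+ 2)) +
  h ^+ 2 * eta / (c * al) * ((r ^+ 2)^-1 * A - al).
  by field; rewrite !gt_eqF.
by rewrite !addr_ge0.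
Qed.

(** * The radial weight [k] of the field *)

Section weight.
Context {R : realType}.
Variables (q q' : R -> R).
Hypothesis hq : forall r : R, 1 < r ->
  is_derive r (1 : R) q (q' r) /\ {for r, continuous q'}.

(** In the variable [t = |x|^2], so that [theta (|x|^2) x] is the radial vector of length [q (|x|)];
    for [q = F' / F] this is the gradient of [log F(|x|)]. *)
Definition theta t : R := q (Num.sqrt t) / Num.sqrt t.
Definition dtheta t : R := q' (Num.sqrt t) / (2 * t) - q (Num.sqrt t) / (2 * t * Num.sqrt t).

Let sqrt_gt1 (t : R) : 1 < t -> 1 < Num.sqrt t.
Proof. by move=> t1; rewrite -[ltLHS]sqrtr1 ltr_sqrt// (lt_trans _ t1). Qed.

Let sqrt_sqr (t : R) : 1 < t -> Num.sqrt t ^+ 2 = t.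
Proof. by move=> t1; rewrite sqr_sqrtr// ltW// (lt_trans ltr01). Qed.

Let cq r : 1 < r -> {for r, continuous q}.
Proof.
by move=> /hq[[dq _] _]; apply/differentiable_continuous/derivable1_diffP.
Qed.

Let continuous_comp_sqrt (g : R -> R) (t : R) : {for Num.sqrt t, continuous g} ->
  {for t, continuous (fun s => g (Num.sqrt s))}.
Proof.
by move=> cg; apply: (@continuous_comp _ _ _ Num.sqrt g) => //; exact: sqrt_continuous.
Qed.

Lemma is_derive_theta (t : R) : 1 < t -> is_derive t (1 : R) theta (dtheta t).
Proof.
move=> t1; have t0 : 0 < t by rewrite (lt_trans ltr01).
have s1 := sqrt_gt1 t1; have s0 : Num.sqrt t != 0 by rewrite gt_eqF// (lt_trans ltr01).
have ds := is_derive1_sqrt t0; have [dq _] := hq s1.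
have dqs := @is_derive_chain R _ q Num.sqrt t 1 _ _ dq ds.
have dv := is_deriveV s0 ds.
have := is_derive_mul dqs dv; congr (is_derive _ _ _ _).
rewrite /GRing.scale/= /dtheta (_ : 2 * t = 2 * Num.sqrt t ^+ 2); last by rewrite sqrt_sqr.
by field.
Qed.

Lemma continuous_theta (t : R) : 1 < t -> {for t, continuous theta}.
Proof.
by move=> /is_derive_theta[dt _]; apply/differentiable_continuous/derivable1_diffP.
Qed.

Lemma continuous_dtheta (t : R) : 1 < t -> {for t, continuous dtheta}.
Proof.
move=> t1; have s1 := sqrt_gt1 t1; have [_ cq'] := hq s1.
have t0 : t != 0 by rewrite gt_eqF// (lt_trans ltr01).
have s0 : Num.sqrt t != 0 by rewrite gt_eqF// (lt_trans ltr01).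
have c2 : {for t, continuous (fun s : R => 2 * s)}.
  by apply: cvgM; [exact: cvg_cst|exact: cvg_id].
have cs : {for t, continuous (fun s : R => 2 * s * Num.sqrt s)}.
  by apply: continuous_atM => //; exact: sqrt_continuous.
apply: cvgB.
  apply: cvgM; first exact: continuous_comp_sqrt.
  by apply: cvgV => //; rewrite mulf_neq0.
apply: cvgM; first exact/continuous_comp_sqrt/cq.
by apply: cvgV => //; rewrite !mulf_neq0.
Qed.

Definition weight n t := psi t * chi n t * theta t.
Definition dweight n t :=
  (dpsi t * chi n t + psi t * dchi n t) * theta t + psi t * chi n t * dtheta t.

(** Since [theta] is regular only for [t > 1] and the cut-off vanishes up to 2, regularity on the
    line splits at 1: at [t <= 1] the function is locally zero, beyond 1 [theta] is regular. *)
Let near_lt2 (P : R -> R) (t : R) : t <= 1 -> (forall s, s <= 2 -> P s = 0) ->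
  \forall s \near t, P s = 0.
Proof.
move=> t1 P0; near=> s; rewrite P0//; apply: ltW; near: s; apply: lt_nbhsl.
by rewrite (le_lt_trans t1)// ltr1n.
Unshelve. all: by end_near. Qed.

Lemma is_derive_weight n (t : R) : is_derive t (1 : R) (weight n) (dweight n t).
Proof.
have [t1|t1] := leP t 1.
  apply: (@near_eq_is_derive _ _ _ (cst 0)).
    have : \forall s \near t, weight n s = 0.
      by apply: near_lt2 => // s s2; rewrite /weight psi_le2// !mul0r.
    by apply: filterS => s ->.
  have t2 : t <= 2 by rewrite (le_trans t1)// ler1n.
  by rewrite /dweight psi_le2// dpsi_le2// !mul0r !addr0 mul0r; exact: is_derive_cst.
have := is_derive_mul (is_derive_mul (is_derive_psi t) (is_derive_chi n t)) (is_derive_theta t1).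
by congr (is_derive _ _ _ _); rewrite /dweight; ring.
Qed.

Lemma continuous_dweight n : continuous (dweight n).
Proof.
have cpsi : continuous (@psi R).
  by move=> t; apply/differentiable_continuous/derivable1_diffP; have [] := is_derive_psi t.
have cchi : continuous (@chi R n).
  by move=> t; apply/differentiable_continuous/derivable1_diffP; have [] := is_derive_chi n t.
have c1 := continuous_add (continuous_mul (@continuous_dpsi R) cchi)
  (continuous_mul cpsi (@continuous_dchi R n)).
have c2 := continuous_mul cpsi cchi.
move=> t; have [t1|t1] := leP t 1.
  apply: (@near_cst_continuous _ _ 0).
  by apply: near_lt2 => // s s2; rewrite /dweight psi_le2// dpsi_le2// !mul0r !addr0 mul0r.
apply: cvgD; apply: cvgM; [exact: c1|exact: continuous_theta|exact: c2|].
exact: continuous_dtheta.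
Qed.

Lemma continuous_dpsi_theta : continuous (fun t => dpsi t * theta t).
Proof.
move=> t; have [t1|t1] := leP t 1.
  apply: (@near_cst_continuous _ _ 0).
  by apply: (near_lt2 (P := fun t => dpsi t * theta t)) => // s s2; rewrite dpsi_le2// mul0r.
by apply: continuous_atM; [exact: continuous_dpsi|exact: continuous_theta].
Qed.

(** The weight already vanishes from [n.+1] on. The square matches a support inside the cube of
    half-side [n.+1], the form in which the divergence is integrated. *)
Lemma weight_out n t : n.+1%:R ^+ 2 < t -> weight n t = 0.
Proof.
move=> nt; rewrite /weight chi_out ?(mulr0, mul0r)//.
by rewrite (le_trans _ (ltW nt))// expr2 ler_peMr// ler1n.
Qed.

End weight.

(** * The Lyapunov estimate *)

(** Here [x] stands for the energy of [h], [y] for the integral of [h^2] over [Q] and [z] for the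
    cut-off integral. If [x] or [y] is infinite, so is the right side; otherwise this is real
    arithmetic. *)
Lemma lee_combine (R : realType) (c k m : R) (x y z : \bar R) :
  0 < c -> 0 <= k -> 0 < m -> (0 <= y -> 0 <= x -> 0 <= z -> z <= x + k%:E * y ->
  c%:E * z + m%:E * y <= (c * (1 + k) + m)%:E * (x + y))%E.
Proof.
move=> c0 k0 m0.
have K0 : 0 < c * (1 + k) + m by rewrite ltr_wpDl// mulr_ge0 ?(ltW c0)// addr_ge0.
have [->|yoo] := eqVneq y +oo%E.
  by move=> _ x0 _ _; rewrite addey ?gt0_muley ?lte_fin ?leey// gt_eqF// (lt_le_trans _ x0).
have [->|xoo] := eqVneq x +oo%E.
  by move=> y0 _ _ _; rewrite addye ?gt0_muley ?lte_fin ?leey// gt_eqF// (lt_le_trans _ y0).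
case: x xoo => // x _; case: y yoo => // y _.
rewrite !lee_fin => y0 x0; case: z => // z; rewrite !lee_fin => z0 zle.
have : c * z <= c * (x + k * y) by rewrite ler_pM2l.
have := mulr_ge0 (ltW c0) y0; have := mulr_ge0 (ltW m0) x0.
have := mulr_ge0 (mulr_ge0 (ltW c0) k0) x0.
rewrite !mulrDl !mulrDr !mulr1 mulrA; lra.
Qed.

Section lyapunov.
Context {R : realType} {d : nat}.
Local Notation lebn := (@lebesgue_rV R d).
Variables (a : 'rV[R]_d -> 'M[R]_d) (V : 'rV[R]_d -> R).
Hypothesis hd : (0 < d)%N.
Hypothesis hpos : forall x, sym_posdef (a x).
Hypothesis ha : forall i j, Ck 2 (fun x => a x i j).
Hypothesis hV : Ck 2 V.
Variables (c : R) (q q' : R -> R).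
Hypothesis c0 : 0 < c.
Hypothesis hq : forall r, 1 < r ->
  [/\ 0 <= q r, is_derive r (1 : R) q (q' r), {for r, continuous q'} &
      q' r + gamma a V r * q r + q r ^+ 2 <= - (c * alpha a r)^-1].

Let asym x : (a x)^T = a x. Proof. by have [] := hpos x. Qed.
Let apos x v : v != 0 -> 0 < inner (mulrV (a x) v) v.
Proof. by have [_] := hpos x; apply. Qed.

Lemma quadratic_ge0 x v : 0 <= inner (mulrV (a x) v) v.
Proof.
have [->|v0] := eqVneq v 0; last by rewrite ltW// apos.
by rewrite /inner big1// => i _; rewrite [X in _ * X]mxE mulr0.
Qed.

(** Cauchy-Schwarz for [a x], as the quadratic form at [v - t w]. It is applied with [v = grad h],
    [w = x] and [t = h q / |x|]. *)
Lemma quadratic_sub_ge0 x (v w : 'rV[R]_d) t :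
  0 <= inner (mulrV (a x) v) v - 2 * (t * inner (mulrV (a x) w) v) +
       t ^+ 2 * inner (mulrV (a x) w) w.
Proof.
have := quadratic_ge0 x (v + (- t) *: w).
rewrite mulrVD mulrVZ !(innerDl, innerDr, innerZl, innerZr).
rewrite (inner_mulrVC v w (asym x)); congr (0 <= _); ring.
Qed.

Let ca i j : continuous (fun x => a x i j). Proof. by have [] := ha i j. Qed.
Let cV : continuous V. Proof. by have [] := hV. Qed.

Lemma continuous_drift i : continuous (fun x => drift a V x ord0 i).
Proof.
under eq_fun do rewrite mxE.
apply: continuous_sum => j; apply: continuous_add.
  apply: continuous_mul; first exact: ca.
  by have [_ /(_ j)[_ []]] := hV.
by have [_ /(_ j)[_ []]] := ha i j.
Qed.

Lemma continuous_expV : continuous (fun x => expR (V x)).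
Proof.
by move=> x; apply: (@continuous_comp _ _ _ V expR); [exact: cV|exact: continuous_expR].
Qed.

Let A x := inner (mulrV (a x) x) x.

Let cA : continuous A. Proof. by apply: continuous_quadratic; exact: ca. Qed.

Definition energy (h : 'rV[R]_d -> R) x := inner (mulrV (a x) (grad h x)) (grad h x).

Lemma continuous_energy h : Ck 1 h -> continuous (energy h).
Proof.
move=> [_ dh].
have cg i : continuous (fun x => grad h x ord0 i).
  by under eq_fun do rewrite mxE; have [] := dh i.
by apply: continuous_inner => //; exact: continuous_mulrV.
Qed.

Let hq1 (r : R) : 1 < r -> is_derive r (1 : R) q (q' r) /\ {for r, continuous q'}.
Proof. by move=> /hq[]. Qed.

Lemma weighted_div_le h n x :
  weighted_div a V h (weight q n) (dweight q q' n) x <= expR (V x) *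
   (psi (inner x x) * chi n (inner x x) * energy h x -
    psi (inner x x) * chi n (inner x x) * h x ^+ 2 / c +
    2 * dpsi (inner x x) * theta q (inner x x) * A x * h x ^+ 2).
Proof.
(* Where the Riccati inequality may be missing, the cut-off and its slope are zero and both sides
   vanish. *)
have [x2|x2] := leP (inner x x) 2.
  rewrite /weighted_div /weight /dweight (psi_le2 x2) (dpsi_le2 x2).
  by rewrite !(mul0r, mulr0, addr0, subr0, oppr0).
rewrite /weighted_div ler_wpM2l ?expR_ge0//.
have r1 : 1 < enorm x.
  by rewrite -[ltLHS]sqrtr1 /enorm ltr_sqrt// (lt_trans _ x2)// ?ltr1n// ltr0n.
have r0 : 0 < enorm x := lt_trans ltr01 r1.
have x0 : x != 0 by rewrite -enorm_gt0.
have xx0 := inner_ge0 x.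
have [q0 _ _ hr] := hq r1.
(* The slope of the whole cut-off is at most that of the inner one: [chi] is at most 1, and the term
   with [dchi] is nonpositive. The bound does not depend on [n]. *)
have etaE : dpsi (inner x x) * chi n (inner x x) + psi (inner x x) * dchi n (inner x x)
    <= dpsi (inner x x).
  have h1 : dpsi (inner x x) * chi n (inner x x) <= dpsi (inner x x).
    by rewrite ler_piMr ?dpsi_ge0// chi_le1.
  have h2 : psi (inner x x) * dchi n (inner x x) <= 0.
    by rewrite mulr_ge0_le0 ?psi_ge0// dchi_le0.
  lra.
have := @riccati_algebra R (enorm x) (A x) (\tr (a x) + inner (drift a V x) x)
  (gamma a V (enorm x)) (q (enorm x)) (q' (enorm x))
  (inner (mulrV (a x) x) (grad h x)) (energy h x) (h x) c (alpha a (enorm x))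
  (psi (inner x x) * chi n (inner x x)) _ (dpsi (inner x x))
  r0 (apos x x0) q0 c0 (alpha_gt0 hd ca apos r0) _ etaE.
rewrite enorm_sqr; apply => //.
- by rewrite mulr_ge0 ?psi_ge0 ?chi_ge0.
- exact: (gamma_ge hd ca continuous_drift apos x0).
- by have := alpha_le hd ca x0; rewrite enorm_sqr.
- exact: quadratic_sub_ge0.
Qed.

(** [P] may have infinite integral, as the energy may be infinite, so [f] is compared with [P]
    through its positive part. *)
Lemma integral_le_ge0 (f : 'rV[R]_d -> R) (P : 'rV[R]_d -> \bar R) :
  lebn.-integrable setT (EFin \o f) -> measurable_fun setT P ->
  (forall x, 0 <= P x)%E -> (forall x, (f x)%:E <= P x)%E ->
  (\int[lebn]_x (f x)%:E <= \int[lebn]_x P x)%E.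
Proof.
move=> intf mP P0 fP; rewrite integralE.
apply: (@le_trans _ _ (\int[lebn]_x (EFin \o f)^\+ x)%E).
  rewrite -[leRHS]sube0; apply: leeB => //.
  by apply: integral_ge0 => x _; exact: funeneg_ge0.
apply: ge0_le_integral => //.
- by apply: measurable_funepos; exact: measurable_int intf.
- by move=> x _; rewrite funeposE ge_max fP P0.
Qed.

Let W x := expR (V x).
Let Q : set 'rV[R]_d := cube 2 d.

Lemma enorm_sqr_out_cube x : ~ Q x -> 3 <= inner x x.
Proof.
move=> xQ; have [i xi] : exists i, 2 < `|x ord0 i|.
  apply: contrapT => nex; apply: xQ => i; rewrite leNgt; apply/negP => xi.
  by apply: nex; exists i.
have := coord_le_enorm x i; rewrite -enorm_sqr => h.
have h2 : 2 < enorm x by exact: lt_le_trans h.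
have : 2 * 2 <= enorm x * enorm x by apply: ler_pM => //; exact: ltW.
rewrite -expr2; lra.
Qed.

(** The coefficient of [h^2] caused by the slope of [psi]: continuous and zero off [Q], hence
    bounded. *)
Let m x := 2 * dpsi (inner x x) * theta q (inner x x) * A x.

Let cm : continuous m.
Proof.
rewrite (_ : m = fun x => 2 * (dpsi (inner x x) * theta q (inner x x)) * A x).
  apply: continuous_mul; last exact: cA.
  apply: continuous_mul; first exact: cst_continuous.
  move=> x; apply: (@continuous_comp _ _ _ (fun x : 'rV[R]_d => inner x x)
    (fun t => dpsi t * theta q t)); first exact: continuous_inner_self.
  exact: (continuous_dpsi_theta hq1).
by apply/funext => x; rewrite /m !mulrA.
Qed.

Let m_out x : ~ Q x -> m x = 0.
Proof.
by move=> /enorm_sqr_out_cube h; rewrite /m dpsi_ge3// mulr0 !mul0r.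
Qed.

Lemma weighted_L2_bound : exists2 K : R, 0 < K & forall h, Ck 1 h ->
  (\int[lebn]_x (W x * h x ^+ 2)%:E <=
   K%:E * (\int[lebn]_x (W x * energy h x)%:E + \int[lebn]_(x in Q) (h x ^+ 2)%:E))%E.
Proof.
(* [M] bounds [e^V] on [Q] and [K1] bounds [m]. Their product controls the error of the inner
   cut-off, and [M] alone the part of the left side where [psi] is below 1. *)
have [M M0 hM] := cube_bounded 2 continuous_expV.
have [K1 K10 hK1] := cube_bounded 2 cm.
pose K2 := M * K1.
exists (c * (1 + K2) + M) => [|h hh].
  by rewrite ltr_wpDl// mulr_ge0 ?(ltW c0)// addr_ge0// mulr_ge0// ltW.
have ch : continuous h by have [] := hh.
have ch2 := continuous_sqr ch.
have cWh := continuous_mul continuous_expV ch2.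
have cWE := continuous_mul continuous_expV (continuous_energy hh).
have WE0 x : 0 <= W x * energy h x by rewrite mulr_ge0 ?expR_ge0 ?quadratic_ge0.
have mQ : measurable Q by exact: cube_measurable.
have mWE : measurable_fun setT (fun x => (W x * energy h x)%:E).
  by apply/measurable_EFinP; exact: continuous_measurable_rV.
have mh2 : measurable_fun setT (fun x => (h x ^+ 2)%:E).
  by apply/measurable_EFinP; exact: continuous_measurable_rV.
have mWh : measurable_fun setT (fun x => (W x * h x ^+ 2)%:E).
  by apply/measurable_EFinP; exact: continuous_measurable_rV.
pose hQ := (fun x => (h x ^+ 2)%:E) \_ Q.
have mhQ : measurable_fun setT hQ.
  by apply: (measurable_restrictT _ mQ).1; exact: measurable_funTS.
have hQ0 x : (0 <= hQ x)%E.
  by rewrite /hQ patchE; case: ifP => // _; rewrite lee_fin sqr_ge0.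
have hQE : (\int[lebn]_x hQ x = \int[lebn]_(x in Q) (h x ^+ 2)%:E)%E.
  by rewrite [RHS]integral_mkcond.
pose B n x := W x * (psi (inner x x) * chi n (inner x x) * h x ^+ 2 / c).
pose Binf x := W x * (psi (inner x x) * h x ^+ 2 / c).
have K20 : 0 <= K2 by rewrite mulr_ge0// ltW.
pose P x := ((W x * energy h x)%:E + K2%:E * hQ x)%E.
have mK2hQ : measurable_fun setT (fun x => K2%:E * hQ x)%E by exact: measurable_funeM.
have mP : measurable_fun setT P by exact: emeasurable_funD.
have P0 x : (0 <= P x)%E.
  by rewrite adde_ge0 ?lee_fin// mule_ge0// lee_fin.
have intP : (\int[lebn]_x P x =
    \int[lebn]_x (W x * energy h x)%:E + K2%:E * \int[lebn]_(x in Q) (h x ^+ 2)%:E)%E.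
  have WE0' x : setT x -> (0 <= (W x * energy h x)%:E)%E by rewrite lee_fin.
  have hK0 x : setT x -> (0 <= K2%:E * hQ x)%E by rewrite mule_ge0// lee_fin.
  rewrite (ge0_integralD lebn measurableT WE0' mWE hK0 mK2hQ).
  by rewrite ge0_integralZl// hQE.
have cpsi : continuous (fun x : 'rV[R]_d => psi (inner x x)).
  move=> x; apply: (@continuous_comp _ _ _ (fun x : 'rV[R]_d => inner x x) psi).
    exact: continuous_inner_self.
  by apply/differentiable_continuous/derivable1_diffP; have [] := is_derive_psi (inner x x).
have cchi n : continuous (fun x : 'rV[R]_d => chi n (inner x x)).
  move=> x; apply: (@continuous_comp _ _ _ (fun x : 'rV[R]_d => inner x x) (chi n)).
    exact: continuous_inner_self.
  by apply/differentiable_continuous/derivable1_diffP; have [] := is_derive_chi n (inner x x).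
have cc : continuous (fun _ : 'rV[R]_d => c^-1 : R) by exact: cst_continuous.
have cB n : continuous (B n).
  exact: (continuous_mul continuous_expV
    (continuous_mul (continuous_mul (continuous_mul cpsi (cchi n)) ch2) cc)).
have cBinf : continuous Binf.
  exact: (continuous_mul continuous_expV (continuous_mul (continuous_mul cpsi ch2) cc)).
have B0 n x : 0 <= B n x.
  apply: mulr_ge0; first exact: expR_ge0.
  apply: mulr_ge0; last by rewrite invr_ge0 ltW.
  apply: mulr_ge0; last exact: sqr_ge0.
  by apply: mulr_ge0; [exact: psi_ge0|exact: chi_ge0].
have Binf0 x : 0 <= Binf x.
  apply: mulr_ge0; first exact: expR_ge0.
  apply: mulr_ge0; last by rewrite invr_ge0 ltW.
  by apply: mulr_ge0; [exact: psi_ge0|exact: sqr_ge0].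
have B_le n : (\int[lebn]_x (B n x)%:E <= \int[lebn]_x P x)%E.
  pose D := weighted_div a V h (weight q n) (dweight q q' n).
  pose N : R := n.+1%:R.
  have N0 : 0 <= N by rewrite ler0n.
  have dk := @is_derive_weight R q q' hq1 n.
  have ck' := @continuous_dweight R q q' hq1 n.
  have k0 := @weight_out R q n.
  have cD : continuous D := continuous_weighted_div asym ha hV hh dk ck'.
  have D0 : forall x, ~ cube N d x -> D x = 0 :=
    weighted_div_out_cube asym ha hV hh dk N0 k0.
  have iD : lebn.-integrable setT (EFin \o D) := continuous_integrable cD D0.
  have B_out x : ~ cube N d x -> B n x = 0.
    move=> xN; rewrite /B chi_out ?(mulr0, mul0r)//.
    have [i xi] : exists i, N < `|x ord0 i|.
      apply: contrapT => nex; apply: xN => i; rewrite leNgt; apply/negP => xi.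
      by apply: nex; exists i.
    have Nx : N < enorm x := lt_le_trans xi (coord_le_enorm x i).
    rewrite -enorm_sqr; have N1 : 1 <= N by rewrite ler1n.
    apply: (@le_trans _ _ (N * 1)); first by rewrite mulr1.
    by rewrite expr2 ler_pM// ?(ltW Nx)// (le_trans N1)// ltW.
  have iB : lebn.-integrable setT (EFin \o B n) := continuous_integrable (cB n) B_out.
  (* The divergence [D] has integral zero, so it may be added for free. Thanks to the outer cut-off
     both functions vanish off a cube, which makes the sum integrable whatever the growth of [h]. *)
  have -> : (\int[lebn]_x (B n x)%:E = \int[lebn]_x (B n x + D x)%:E)%E.
    under [RHS]eq_integral do rewrite EFinD.
    rewrite integralD_EFin//.
    rewrite [X in (_ = _ + X)%E](_ : _ = 0%E) ?adde0//.
    exact: (integral_weighted_div asym ha hV hh dk ck' N0 k0).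
  apply: integral_le_ge0 => //.
    rewrite (_ : _ \o _ = (EFin \o B n) \+ (EFin \o D))%E; first exact: integrableD.
    by apply/funext => x /=; rewrite EFinD.
  move=> x; have Dle := weighted_div_le h n x.
  have BD : B n x + D x <= W x * energy h x + W x * (m x * h x ^+ 2).
    apply: (@le_trans _ _ (W x * (psi (inner x x) * chi n (inner x x) * energy h x +
       m x * h x ^+ 2))).
      rewrite -lerBrDl (le_trans Dle)// /B -mulrBr ler_wpM2l ?expR_ge0// /m.
      by rewrite le_eqVlt; apply/orP; left; apply/eqP; ring.
    rewrite mulrDr lerD2r ler_wpM2l ?expR_ge0// ler_piMl ?quadratic_ge0//.
    by rewrite mulr_ile1 ?psi_ge0 ?chi_ge0 ?psi_le1 ?chi_le1 ?inner_ge0.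
  apply: (@le_trans _ _ (W x * energy h x + W x * (m x * h x ^+ 2))%:E).
    by rewrite lee_fin.
  rewrite EFinD /P leeD2l// /hQ patchE; case: ifPn => [/set_mem xQ|/negP xQ].
    rewrite -EFinM lee_fin mulrA ler_wpM2r ?sqr_ge0// /K2.
    have Wx := hM x xQ; have mx := hK1 x xQ.
    rewrite (le_trans (ler_norm _))// normrM ler_pM//.
  by rewrite mule0 m_out ?(mul0r, mulr0)// => xQ'; apply: xQ; exact/mem_set.
(* [B n] increases to [Binf] with [chi n], and its integral is bounded uniformly in [n]. *)
have Binf_le : (\int[lebn]_x (Binf x)%:E <= \int[lebn]_x P x)%E.
  have BE x : limn (fun n => (B n x)%:E) = (Binf x)%:E.
    apply/cvg_lim => //; apply: cvg_EFin; first exact: nearW.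
    rewrite /Binf /B; apply: cvgM; first exact: cvg_cst.
    apply: cvgM; last exact: cvg_cst; apply: cvgM; last exact: cvg_cst.
    rewrite -[X in _ --> X]mulr1; apply: cvgM; first exact: cvg_cst.
    exact: cvg_chi.
  have := @cvg_monotone_convergence _ _ _ lebn setT measurableT (fun n x => (B n x)%:E).
  under [X in _ -> _ -> _ -> _ --> X]eq_integral do rewrite BE.
  move=> mc; have {mc}cvgB : (\int[lebn]_x (B n x)%:E)%E @[n --> \oo] -->
      (\int[lebn]_x (Binf x)%:E)%E.
    apply: mc.
    - by move=> n; apply/measurable_EFinP; exact: continuous_measurable_rV.
    - by move=> n x _; rewrite lee_fin.
    - move=> x _ k l kl; rewrite lee_fin ler_wpM2l ?expR_ge0// ler_wpM2r ?invr_ge0 ?(ltW c0)//.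
      by rewrite ler_wpM2r ?sqr_ge0// ler_wpM2l ?psi_ge0// chi_mono ?inner_ge0.
  rewrite -(cvg_lim _ cvgB)//; apply: lime_le.
    by apply/cvg_ex; eexists; exact: cvgB.
  exact: nearW.
(* Off [Q] the factor [psi] is 1, so [c * Binf] equals the left side; on [Q] the bound [M] on [e^V]
   is enough. *)
have Wh_le x : ((W x * h x ^+ 2)%:E <= c%:E * (Binf x)%:E + M%:E * hQ x)%E.
  rewrite -EFinM /hQ patchE; case: ifPn => [/set_mem xQ|/negP xQ].
    rewrite -EFinM -EFinD lee_fin ler_wpDl//; first by rewrite mulr_ge0// ltW.
    rewrite ler_wpM2r ?sqr_ge0//; apply: le_trans (hM x xQ); exact: ler_norm.
  rewrite mule0 adde0 lee_fin /Binf psi_ge3; last first.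
    by apply: enorm_sqr_out_cube => xQ'; apply: xQ; exact/mem_set.
  rewrite le_eqVlt; apply/orP; left; apply/eqP.
  by field; rewrite gt_eqF.
have mB : measurable_fun setT (fun x => (Binf x)%:E).
  by apply/measurable_EFinP; exact: continuous_measurable_rV.
have mcB : measurable_fun setT (fun x => c%:E * (Binf x)%:E)%E by exact: measurable_funeM.
have mMh : measurable_fun setT (fun x => M%:E * hQ x)%E by exact: measurable_funeM.
have cge0 := ltW c0; have Mge0 := ltW M0.
apply: (@le_trans _ _ (\int[lebn]_x (c%:E * (Binf x)%:E + M%:E * hQ x))%E).
  apply: ge0_le_integral => //.
  - by move=> x _; rewrite lee_fin mulr_ge0 ?expR_ge0 ?sqr_ge0.
  - exact: emeasurable_funD.
have cB0 x : setT x -> (0 <= c%:E * (Binf x)%:E)%E by rewrite -EFinM lee_fin mulr_ge0.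
have Mh0 x : setT x -> (0 <= M%:E * hQ x)%E by rewrite mule_ge0.
rewrite (ge0_integralD lebn measurableT cB0 mcB Mh0 mMh).
rewrite ge0_integralZl//; last by move=> x _; rewrite lee_fin.
rewrite ge0_integralZl// hQE.
move: Binf_le; rewrite intP.
have : (0 <= \int[lebn]_x (Binf x)%:E)%E by apply: integral_ge0 => x _; rewrite lee_fin.
have : (0 <= \int[lebn]_x (W x * energy h x)%:E)%E.
  by apply: integral_ge0 => x _; rewrite lee_fin.
have : (0 <= \int[lebn]_(x in Q) (h x ^+ 2)%:E)%E.
  by apply: integral_ge0 => x _; rewrite lee_fin sqr_ge0.
exact: lee_combine.
Qed.

End lyapunov.

(** * The Gibbs measure *)

Section density.
Context d (T : measurableType d) (R : realType).
Variables (mu : {measure set T -> \bar R}) (w : T -> R).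
Hypotheses (mw : measurable_fun setT w) (w0 : forall x, 0 <= w x).
Local Open Scope ereal_scope.

(** The proofs are carried as arguments so that the measure structure can be attached to the term
    itself. *)
Definition density (_ : measurable_fun setT w) (_ : forall x, (0 <= w x)%R) :
  set T -> \bar R := fun A => \int[mu]_(x in A) (w x)%:E.

Local Notation nu := (density mw w0).

Let density0 : nu set0 = 0.
Proof. by rewrite /density integral_set0. Qed.

Let density_ge0 A : 0 <= nu A.
Proof. by apply: integral_ge0 => x _; rewrite lee_fin. Qed.

Let density_sigma_additive : semi_sigma_additive nu.
Proof.
move=> F mF tF mUF; rewrite /density ge0_integral_bigcup//; last 2 first.
- by apply/measurable_EFinP; exact: measurable_funTS.
- by move=> x _; rewrite lee_fin.
by apply: is_cvg_nneseries => n _ _; exact: density_ge0.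
Qed.

HB.instance Definition _ := isMeasure.Build _ _ _ nu
  density0 density_ge0 density_sigma_additive.

Import HBNNSimple.

(** For an indicator this is the definition of [density]. Linearity gives simple functions, and
    monotone convergence on both sides gives the rest. *)
Lemma ge0_integral_density (f : T -> \bar R) : measurable_fun setT f ->
  (forall x, 0 <= f x) -> \int[nu]_x f x = \int[mu]_x (f x * (w x)%:E).
Proof.
move=> mf f0.
pose h := nnsfun_approx measurableT mf.
have hf x : (EFin \o h ^~ x) @ \oo --> f x.
  exact: (cvg_nnsfun_approx measurableT mf (fun x _ => f0 x)).
have mh n : measurable_fun setT (EFin \o h n) by apply/measurable_EFinP.
have mwE : measurable_fun setT (EFin \o w) by apply/measurable_EFinP.
have nd x : {homo (h ^~ x) : n m / (n <= m)%N >-> (n <= m)%R}.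
  by move=> n m nm; exact/lefP/nd_nnsfun_approx.
have c1 : \int[nu]_x (h n x)%:E @[n --> \oo] --> \int[nu]_x f x.
  have := @cvg_monotone_convergence d T R nu setT measurableT
    (fun n => EFin \o h n).
  rewrite (_ : (fun x => limn ((fun n => EFin \o h n) ^~ x)) = f); last first.
    by apply/funext => x; apply/cvg_lim => //; exact: hf.
  apply => //.
  - by move=> n x _; rewrite lee_fin.
  - by move=> x _ n m nm; rewrite lee_fin; exact: nd.
have c2 : \int[mu]_x ((h n x)%:E * (w x)%:E) @[n --> \oo] --> \int[mu]_x (f x * (w x)%:E).
  have := @cvg_monotone_convergence _ _ _ mu setT measurableT
    (fun n x => (h n x)%:E * (w x)%:E).
  rewrite (_ : (fun x => limn ((fun n x => (h n x)%:E * (w x)%:E) ^~ x)) =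
      fun x => f x * (w x)%:E); last first.
    by apply/funext => x; apply/cvg_lim => //; apply: cvgeZr => //; exact: hf.
  apply.
  - by move=> n; exact: (emeasurable_funM (mh n) mwE).
  - by move=> n x _; rewrite mule_ge0// lee_fin.
  - by move=> x _ n m nm; rewrite lee_wpmul2r ?lee_fin//; exact: nd.
suff hE n : \int[nu]_x (h n x)%:E = \int[mu]_x ((h n x)%:E * (w x)%:E).
  rewrite -(cvg_lim _ c1)// -(cvg_lim _ c2)//; congr (lim (_ @ \oo)).
  by apply/funext => n; exact: hE.
rewrite integralT_nnsfun sintegralE.
under [RHS]eq_integral do rewrite (fimfunE (h n)) -fsumEFin//.
under [RHS]eq_integral => x _.
  rewrite ge0_mule_fsuml; last by move=> y; exact: nnfun_muleindic_ge0.
  over.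
rewrite ge0_integral_fsum//; last 2 first.
- move=> r; apply: emeasurable_funM => //; apply/measurable_EFinP.
  by apply: measurable_funM => //; exact: measurable_indic.
- move=> r x _; apply: mule_ge0; last by rewrite lee_fin.
  by rewrite EFinM; exact: nnfun_muleindic_ge0.
apply: eq_fsbigr => r /set_mem [x _ hr].
have r0 : (0 <= r)%R by rewrite -hr.
under eq_integral do rewrite EFinM -muleA.
rewrite ge0_integralZl//; last 2 first.
- by apply: emeasurable_funM => //; apply/measurable_EFinP; exact: measurable_indic.
- by move=> y _; rewrite mule_ge0 ?lee_fin.
congr (_ * _); rewrite /density [LHS]integral_mkcond.
apply: eq_integral => y _; rewrite patchE indicE.
by case: (y \in _); rewrite ?mul1e ?mul0e.
Qed.

End density.

Section variance.
Context d (T : measurableType d) (R : realType) (mu : {measure set T -> \bar R}).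
Local Open Scope ereal_scope.

(** Expanding the square, the linear term integrates to 0, and the integral is [1 + c^2]. *)
Lemma variance_shift_ge (g : T -> R) (c : R) : mu setT = 1 -> measurable_fun setT g ->
  \int[mu]_x (g x)%:E = 0 -> \int[mu]_x ((g x) ^+ 2)%:E = 1 ->
  1 <= \int[mu]_x ((g x - c) ^+ 2)%:E.
Proof.
move=> mu1 mg g0 g1.
have mg2 : measurable_fun setT (fun x => (g x ^+ 2)%R) by exact: measurable_funX.
have ig2 : mu.-integrable setT (EFin \o (fun x => (g x ^+ 2)%R)).
  apply/integrableP; split; first by apply/measurable_EFinP.
  under eq_integral do rewrite /= ger0_norm ?sqr_ge0//.
  by rewrite g1 ltry.
have icst (k : R) : mu.-integrable setT (EFin \o cst k).
  apply/integrableP; split; first by apply/measurable_EFinP.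
  by rewrite (_ : (fun x => _) = cst `|k|%:E)// integral_cst//= mu1 mule1 ltry.
(* A vanishing integral does not by itself make [g] integrable; this comes from [|g| <= g^2 + 1] and
   the finiteness of [mu]. *)
have ig : mu.-integrable setT (EFin \o g).
  apply: (@le_integrable d T R mu setT measurableT _
    ((EFin \o (fun x => (g x ^+ 2)%R)) \+ (EFin \o cst 1%R))); last exact: integrableD.
    by apply/measurable_EFinP.
  move=> x _; rewrite /= lee_fin (le_trans _ (ler_norm _))//.
  rewrite -(real_normK (num_real (g x))).
  have := sqr_ge0 (`|g x| - 1)%R; have := normr_ge0 (g x); nra.
have igc : mu.-integrable setT (EFin \o (fun x => (- (2 * c) * g x)%R)).
  rewrite (_ : _ \o _ = fun x => (- (2 * c))%:E * (g x)%:E)%E//.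
  exact: integrableZl.
have iaff : mu.-integrable setT (EFin \o (fun x => (- (2 * c) * g x + c ^+ 2)%R)).
  rewrite (_ : _ \o _ = (EFin \o (fun x => (- (2 * c) * g x)%R)) \+ (EFin \o cst (c ^+ 2)%R))//.
  exact: integrableD.
rewrite (_ : (fun x => _) = fun x => (g x ^+ 2)%:E + (- (2 * c) * g x + c ^+ 2)%:E); last first.
  by apply/funext => x; rewrite -EFinD; congr EFin; ring.
rewrite integralD_EFin// g1.
have -> : \int[mu]_x (- (2 * c) * g x + c ^+ 2)%:E = (c ^+ 2)%:E.
  have e1 : \int[mu]_x (- (2 * c) * g x)%:E = 0.
    by under eq_integral do rewrite EFinM; rewrite integralZl// g0 mule0.
  have e2 : \int[mu]_x (cst (c ^+ 2)%:E) x = (c ^+ 2)%:E.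
    by rewrite integral_cst//= mu1 mule1.
  under eq_integral do rewrite EFinD.
  rewrite (integralD_EFin _ igc (icst _))// -[RHS]add0e; congr (_ + _).
    exact: e1.
  exact: e2.
by rewrite leeDl// lee_fin sqr_ge0.
Qed.

End variance.

(** * Ellipticity on cubes and integration against the Gibbs measure *)

Section ellipticity.
Context {R : realType} {d : nat}.
Variables (a : 'rV[R]_d -> 'M[R]_d) (V : 'rV[R]_d -> R).
Hypothesis hd : (0 < d)%N.
Hypothesis ca : forall i j, continuous (fun x => a x i j).
Hypothesis cV : continuous (fun x => expR (V x)).
Hypothesis hpos : forall x, sym_posdef (a x).

(** The function [phi] is continuous and positive on the compact product of the cube and the unit
    sphere, so it has a positive minimum there; homogeneity of degree 2 in [v] does the rest. With
    [e^V] included, the plain gradient on the cube is bounded directly by the weighted energy. *)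
Lemma uniform_ellipticity (N : R) : 0 <= N -> exists2 L : R, 0 < L &
  forall x v : 'rV[R]_d, cube N d x ->
  inner v v <= L * (expR (V x) * inner (mulrV (a x) v) v).
Proof.
move=> N0.
pose phi (p : 'rV[R]_d * 'rV[R]_d) : R :=
  expR (V p.1) * inner (mulrV (a p.1) p.2) p.2.
have c1 : continuous (fun p : 'rV[R]_d * 'rV[R]_d => p.1) by move=> p; exact: cvg_fst.
have c2 : continuous (fun p : 'rV[R]_d * 'rV[R]_d => p.2) by move=> p; exact: cvg_snd.
have cp2 i : continuous (fun p : 'rV[R]_d * 'rV[R]_d => p.2 ord0 i).
  move=> p; apply: (@continuous_comp _ _ _ (fun p : 'rV[R]_d * 'rV[R]_d => p.2)
    (fun x : 'rV[R]_d => x ord0 i)); first exact: c2.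
  exact: continuous_coord.
have cphi : continuous phi.
  apply: continuous_mul.
    move=> p; apply: (@continuous_comp _ _ _ (fun p : 'rV[R]_d * 'rV[R]_d => p.1)
      (fun x : 'rV[R]_d => expR (V x))); first exact: c1.
    exact: cV.
  apply: continuous_inner => //; apply: continuous_mulrV => // i j p.
  apply: (@continuous_comp _ _ _ (fun p : 'rV[R]_d * 'rV[R]_d => p.1)
    (fun x : 'rV[R]_d => a x i j)); first exact: c1.
  exact: ca.
pose S1 := @sphere R d 1.
have K0 : (cube N d `*` S1) !=set0.
  by have [u u1] := sphere_neq0 (R := R) hd ler01; exists (0, u); split => //=; exact: cube0.
have cK : compact (cube N d `*` S1).
  by apply: compact_setX; [exact: cube_compact|exact: sphere_compact].
have [p /set_mem pK pmin] := compact_EVT_min K0 cK (continuous_subspaceT cphi).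
have p2 : p.2 != 0.
  by rewrite -enorm_gt0; case: pK => _ /= ->; exact: ltr01.
have phi0 : 0 < phi p by rewrite mulr_gt0 ?expR_gt0//; have [_] := hpos p.1; apply.
exists (phi p)^-1 => [|x v xN]; first by rewrite invr_gt0.
have [->|v0] := eqVneq v 0.
  have i0 (u : 'rV[R]_d) : inner u 0 = 0.
    by rewrite /inner big1// => i _; rewrite [X in _ * X]mxE mulr0.
  by rewrite !i0 !mulr0.
have ev0 : 0 < enorm v by rewrite enorm_gt0.
pose u := (enorm v)^-1 *: v.
have u1 : S1 u by rewrite /S1 /sphere /= enormZ ?invr_ge0 ?ltW// mulVf// gt_eqF.
have vE : v = enorm v *: u by rewrite /u scalerA divff ?scale1r// gt_eqF.
have : phi p <= phi (x, u) by apply: pmin; apply/mem_set.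
rewrite /phi/= => h.
rewrite ler_pdivlMl// -enorm_sqr [in leRHS]vE mulrVZ innerZl innerZr.
apply: (@le_trans _ _ (expR (V x) * inner (mulrV (a x) u) u * enorm v ^+ 2)).
  by rewrite ler_wpM2r ?sqr_ge0.
by rewrite le_eqVlt; apply/orP; left; apply/eqP; ring.
Qed.

End ellipticity.

Section gibbs_measure.
Context {R : realType} {d : nat}.
Local Notation lebn := (@lebesgue_rV R d).
Variables (V : 'rV[R]_d -> R).
Hypothesis cV : continuous (fun x => expR (V x)).
Hypothesis hZ : (partition_function V < +oo)%E.

Let W x := expR (V x).
Let mW : measurable_fun setT W. Proof. exact: continuous_measurable_rV. Qed.
Let W0 x : 0 <= W x. Proof. exact: expR_ge0. Qed.
Let Z := fine (partition_function V).

Lemma partition_functionE : partition_function V = Z%:E.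
Proof.
rewrite fineK// ge0_fin_numE//; apply: integral_ge0 => x _; exact: W0.
Qed.

Let Z0 : 0 <= Z.
Proof. by rewrite fine_ge0// integral_ge0// => x _; exact: W0. Qed.

Let Zinv0 : 0 <= Z^-1. Proof. by rewrite invr_ge0. Qed.

Let mu : {measure set 'rV[R]_d -> \bar R} :=
  mscale (NngNum Zinv0) (density lebn mW W0).

(** [gibbs] is a bare set function; rewriting with this equality, which holds by conversion, makes
    the results on measures available for it. *)
Lemma gibbsE : gibbs V = mu :> (set 'rV[R]_d -> \bar R).
Proof. by []. Qed.

Lemma ge0_integral_gibbs (f : 'rV[R]_d -> \bar R) : measurable_fun setT f ->
  (forall x, 0 <= f x)%E ->
  (\int[gibbs V]_x f x = (Z^-1)%:E * \int[lebn]_x (f x * (W x)%:E))%E.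
Proof.
move=> mf f0; rewrite gibbsE ge0_integral_mscale//.
by rewrite ge0_integral_density.
Qed.

Lemma gibbs_setT : 0 < Z -> gibbs V setT = 1%E.
Proof.
move=> Zpos; rewrite /gibbs -/Z -/(partition_function V) partition_functionE.
by rewrite -EFinM mulVf// gt_eqF.
Qed.

Lemma gibbs_variance_shift_ge (g : 'rV[R]_d -> R) (c : R) : 0 < Z ->
  measurable_fun setT g -> (\int[gibbs V]_x (g x)%:E = 0)%E ->
  (\int[gibbs V]_x ((g x) ^+ 2)%:E = 1)%E ->
  (1 <= \int[gibbs V]_x ((g x - c) ^+ 2)%:E)%E.
Proof.
move=> Zpos; rewrite gibbsE => mg g0 g1; apply: variance_shift_ge => //.
exact: gibbs_setT.
Qed.

End gibbs_measure.

(** * Shift by a constant and final estimate *)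

Lemma partial_subr_cst (R : realType) d (g : 'rV[R]_d -> R) c i x :
  derivable g x (delta_mx ord0 i) ->
  is_derive x (delta_mx ord0 i) (fun x => g x - c) (partial g i x).
Proof.
move=> /is_derive_partial dg.
by have := is_deriveB dg (is_derive_cst c x (delta_mx ord0 i)); rewrite subr0.
Qed.

Lemma grad_subr_cst (R : realType) d (g : 'rV[R]_d -> R) c : Ck 1 g ->
  Ck 1 (fun x => g x - c) /\ grad (fun x => g x - c) = grad g.
Proof.
move=> [cg dg].
have pE i : partial (fun x => g x - c) i = partial g i.
  by apply/funext => x; have [dgi _] := dg i; have [] := partial_subr_cst c (dgi x).
split; last by apply/funext => x; apply/rowP => i; rewrite !mxE pE.
split; first exact: continuous_subr_cst.
move=> i; have [dgi cgi] := dg i; rewrite pE; split => // x.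
by have [] := partial_subr_cst c (dgi x).
Qed.

(** Roles: [x] is the energy of [g], [y] and [s] are the integrals over [Q] of [h^2] and
    [|grad g|^2], and [w] is that of [e^V h^2]. Chaining gives [z <= k x + k p l x + z / 2], where
    [z / 2] is the error of the Poincare inequality; absorbing it on the left costs the factor 2. *)
Lemma gap_le (R : realType) (z k p l : R) (x y s w : \bar R) :
  0 < z -> 0 < k -> 0 < p -> 0 < l -> (0 <= x -> 0 <= y -> 0 <= s ->
  z%:E <= w -> w <= k%:E * (x + y) -> y <= p%:E * s + (z / (2 * k))%:E ->
  s <= l%:E * x -> ((2 * k * (1 + p * l))^-1)%:E <= (z^-1)%:E * x)%E.
Proof.
move=> z0 k0 p0 l0 x0 y0 s0 zw.
have [->|] := eqVneq x +oo%E; first by move=> _ _ _; rewrite gt0_muley ?leey// lte_fin invr_gt0.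
case: x x0 => // x; rewrite lee_fin => x0 _ wle yle sle.
case: s s0 yle sle => // s; rewrite lee_fin => s0 yle; rewrite lee_fin => sle.
case: y y0 wle yle => // y; rewrite lee_fin => y0 wle; rewrite lee_fin => yle.
have {wle} : z <= k * (x + y) by rewrite -lee_fin; exact: le_trans zw wle.
move=> zle.
have D0 : 0 < 2 * k * (1 + p * l) by rewrite !mulr_gt0// addr_gt0// mulr_gt0.
rewrite lee_fin ler_pdivlMl// ler_pdivrMr//.
have h1 : p * s <= p * (l * x) by rewrite ler_pM2l.
have h2 : k * y <= k * (p * (l * x)) + z / 2.
  have -> : z / 2 = k * (z / (2 * k)) by field; rewrite gt_eqF.
  by rewrite -mulrDr ler_pM2l// (le_trans yle)// lerD2r.
have -> : x * (2 * k * (1 + p * l)) = 2 * (k * x + k * (p * (l * x))) by ring.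
move: zle; rewrite mulrDr; lra.
Qed.

Unset Implicit Arguments.
Set Strict Implicit.

Theorem theorem3p1 (R : realType) (d : nat) (hd : (0 < d)%N)
  (a : 'rV[R]_d -> 'M[R]_d) (V : 'rV[R]_d -> R)
  (ha : forall x, sym_posdef (a x))
  (ha2 : forall i j, Ck 2 (fun x => a x i j))
  (hV2 : Ck 2 V)
  (hZ : (partition_function V < +oo)%E)
  (hreg : regular a V)
  (hf : exists f : R -> R,
    [/\ {within `[1, +oo[, continuous f},
        (forall t, 1 <= t -> 0 < f t) &
        (ereal_sup
          [set ((f t)^-1)%:E *
               \int[lebesgue_measure]_(r in `[1%R, t])
                 ((expR (- Cint a V r))%:E *
                  \int[lebesgue_measure]_(s in `[r, +oo[)
                    (expR (Cint a V s) * (f s / alpha a s))%:E)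
          | t in [set t : R | (1 <= t)%R]] < +oo)%E]) :
  (0 < spectral_gap a V)%E.
Proof.
move: hf => [f [cf f0 fsup]].
have ca i j : continuous (fun x => a x i j) by have [] := ha2 i j.
have apos x v : v != 0 -> 0 < inner (mulrV (a x) v) v by have [_] := ha x; apply.
have cW := continuous_expV hV2.
have [c [q [q' [c0 hq]]]] :=
  riccati_gamma_alpha hd ca (continuous_drift ha2 hV2) apos cf f0 fsup.
have [K K0 hK] := weighted_L2_bound hd ha ha2 hV2 c0 hq.
(* The half-side 2 is that of the cube [Q] in the Lyapunov estimate. *)
have [P P0 hP] := @poincare_cube R 2 d (ltr0Sn R 1).
have [L L0 hL] := uniform_ellipticity hd ca cW ha (ler0n R 2).
have D0 : 0 < 2 * K * (1 + P * L) by rewrite !mulr_gt0// addr_gt0// mulr_gt0.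
apply: (@lt_le_trans _ _ ((2 * K * (1 + P * L))^-1)%:E); first by rewrite lte_fin invr_gt0.
apply: le_ereal_inf_tmp => _ [g [gC g0 g1] <-].
have [cg dg] := gC.
have mg : measurable_fun setT g by exact: continuous_measurable_rV.
set Z := fine (partition_function V).
have msqr (u : 'rV[R]_d -> R) : continuous u -> measurable_fun setT (fun x => (u x ^+ 2)%:E).
  move=> cu; apply/measurable_EFinP; apply: continuous_measurable_rV.
  exact: continuous_sqr.
(* If [Z] were 0, the convention [0^-1 = 0] would make [gibbs V] the zero measure, against
   [mu(g^2) = 1]. *)
have Z0 : 0 < Z.
  have : 0 <= Z by rewrite fine_ge0// integral_ge0// => x _; exact: expR_ge0.
  rewrite le_eqVlt => /predU1P[Z0|//]; move: g1; rewrite ge0_integral_gibbs//.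
  - rewrite -/Z -Z0 invr0 mul0e => /eqP.
    by rewrite eq_sym onee_eq0.
  - exact: msqr.
  - by move=> x; rewrite lee_fin sqr_ge0.
(* Multiplied by [K], this error becomes [Z / 2], half of the lower bound on the integral of
   [e^V h^2]. *)
have e0 : 0 < Z / (2 * K) by rewrite divr_gt0// mulr_gt0.
have [m hm] := hP g gC _ e0.
pose h x := g x - m.
have [hC gradh] := grad_subr_cst m gC.
have mE : measurable_fun setT (EFin \o energy a g).
  apply/measurable_EFinP; apply: continuous_measurable_rV.
  exact: (continuous_energy ha2 gC).
have E0 x : 0 <= energy a g x by exact: (quadratic_ge0 ha).
have -> : (\int[gibbs V]_x (inner (Defs.mulrV (a x) (grad g x)) (grad g x))%:E =
    (Z^-1)%:E * \int[lebesgue_rV d]_x (expR (V x) * energy a g x)%:E)%E.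
  have E0' x : (0 <= (EFin \o energy a g) x)%E by rewrite lee_fin.
  apply: (etrans (ge0_integral_gibbs cW mE E0')); congr (_ * _)%E.
  by apply: eq_integral => x _; rewrite muleC -EFinM.
have WE0 x : 0 <= expR (V x) * energy a g x by rewrite mulr_ge0 ?expR_ge0.
have cWE := continuous_mul cW (continuous_energy ha2 gC).
have mWE : measurable_fun setT (fun x => (expR (V x) * energy a g x)%:E).
  apply/measurable_EFinP; apply: continuous_measurable_rV; exact: cWE.
apply: (@gap_le _ Z K P L _ (\int[lebesgue_rV d]_(x in cube 2 d) (h x ^+ 2)%:E)%E
  (\int[lebesgue_rV d]_(x in cube 2 d) (\sum_i partial g i x ^+ 2)%:E)%E
  (\int[lebesgue_rV d]_x (expR (V x) * h x ^+ 2)%:E)%E) => //.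
- by apply: integral_ge0 => x _; rewrite lee_fin.
- by apply: integral_ge0 => x _; rewrite lee_fin sqr_ge0.
- by apply: integral_ge0 => x _; rewrite lee_fin sumr_ge0// => i _; rewrite sqr_ge0.
(* Since [g] has mean zero, subtracting any constant only increases its second moment, so [m] may be
   dictated by the cube. *)
- have var := gibbs_variance_shift_ge cW hZ m Z0 mg g0 g1.
  have mh2 := msqr _ (continuous_subr_cst (c := m) cg).
  have h20 x : (0 <= ((g x - m) ^+ 2)%:E)%E by rewrite lee_fin sqr_ge0.
  rewrite (ge0_integral_gibbs cW mh2 h20) -/Z in var.
  have hE : (\int[lebesgue_rV d]_x (((g x - m) ^+ 2)%:E * (expR (V x))%:E) =
      \int[lebesgue_rV d]_x (expR (V x) * h x ^+ 2)%:E)%E.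
    by apply: eq_integral => x _; rewrite muleC -EFinM.
  rewrite hE in var.
  have Zge0 : (0 <= Z%:E)%E by rewrite lee_fin ltW.
  have := lee_wpmul2l Zge0 var.
  by rewrite mule1 muleA -EFinM divff ?gt_eqF// mul1e.
- have := hK h hC; rewrite (_ : energy a h = energy a g)//.
  by rewrite /energy gradh.
- have mQ := cube_measurable 2 (n := d) : measurable (cube (2 : R) d).
  have cp i : continuous (partial g i) by have [] := dg i.
  have mL : measurable_fun setT (fun x => L%:E * (expR (V x) * energy a g x)%:E)%E.
    exact: measurable_funeM.
  rewrite -ge0_integralZl//; last 2 first.
  + by move=> x _; rewrite lee_fin.
  + by rewrite lee_fin ltW.
  apply: (@le_trans _ _ (\int[lebesgue_rV d]_(x in cube 2 d)
      (L%:E * (expR (V x) * energy a g x)%:E))%E).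
    apply: ge0_le_integral => //.
    + by move=> x _; rewrite lee_fin sumr_ge0// => i _; rewrite sqr_ge0.
    + apply: measurable_funTS; apply/measurable_EFinP; apply: continuous_measurable_rV.
      by apply: continuous_sum => i; exact/continuous_sqr/cp.
    + exact: measurable_funTS.
    + move=> x xQ; rewrite -EFinM lee_fin.
      have := hL x (grad g x) xQ; rewrite /inner.
      by under eq_bigr do rewrite !mxE -expr2.
  apply: ge0_subset_integral => //.
  by move=> x _; rewrite -EFinM lee_fin mulr_ge0// ltW.
Qed.
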